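(* Let $E$ be a Hilbert $C^*$-module over a $C^*$-algebra $\mathcal{A}$ and let $T$ be a closed, densely defined and symmetric operator in $E$. The following statements are equivalent: (1) $T$ is selfadjoint and regular. (2) For every state $\omega$ on $\mathcal{A}$ the localization $T^\omega$ is a selfadjoint operator in the Hilbert space $E^\omega$.
   Context: $C^*$-algebras are not assumed unital. A Hilbert $C^*$-module $E$ over $\mathcal{A}$ is a right $\mathcal{A}$-module with an $\mathcal{A}$-valued inner product $\langle\cdot,\cdot\rangle$ (conjugate linear in the first, linear in the second variable), complete in the norm $\|x\|=\|\langle x,x\rangle\|^{1/2}$. A semiregular operator in $E$ is an operator $T:\mathrm{dom}(T)\to E$ defined on a dense $\mathcal{A}$-submodule $\mathrm{dom}(T)\subset E$ whose adjoint $T^*$ is densely defined; here $y\in\mathrm{dom}(T^* )$ iff there is $z=T^*y\in E$ with $\langle Tx,y\rangle=\langle x,z\rangle$ for all $x\in\mathrm{dom}(T)$. Such a $T$ is automatically $\mathcal{A}$-linear and closable. A closed semiregular operator $T$ is called regular if $I+T^*T$ has dense range (it is then invertible). A densely defined operator $T$ (domain a dense $\mathcal{A}$-submodule) is symmetric if $T\subset T^*$ and selfadjoint if $T=T^*$; symmetric operators are semiregular. For a state $\omega$ on $\mathcal{A}$, put $\langle x,y\rangle_\omega=\omega(\langle x,y\rangle)$ on $E$ and $\mathcal{N}_\omega=\{x\in E:\langle x,x\rangle_\omega=0\}$; $E^\omega$ is the Hilbert space completion of $E/\mathcal{N}_\omega$ and $\iota_\omega:E\to E^\omega$ is the natural map.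 For a semiregular $T$, the localization $T^\omega$ is the closure of the (well-defined, densely defined, closable) operator $T^\omega_0$ with $\mathrm{dom}(T_0^\omega)=\iota_\omega(\mathrm{dom}(T))$ and $T^\omega_0\iota_\omega(x)=\iota_\omega(Tx)$. *)

(* Defs.v *)
From HB Require Import structures.
From mathcomp Require Import all_boot all_order all_algebra.
From mathcomp Require Import complex.
From mathcomp Require Import all_classical all_reals all_analysis.

Set Implicit Arguments.
Unset Strict Implicit.
Unset Printing Implicit Defensive.

Import Order.TTheory GRing.Theory Num.Theory.
Import numFieldNormedType.Exports.

Local Open Scope classical_set_scope.
Local Open Scope ring_scope.
Local Open Scope complex_scope.

(* The product is a field of the record because MathComp rings are unital. *)
Record cstarAlgebra (R : realType) := CStarAlgebra {
  cs_sort :> completeNormedModType R[i];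
  cs_mul : cs_sort -> cs_sort -> cs_sort;
  cs_star : cs_sort -> cs_sort;
  cs_mulA : associative cs_mul;
  cs_mulDl : left_distributive cs_mul +%R;
  cs_mulDr : right_distributive cs_mul +%R;
  cs_mulZl : forall (k : R[i]) (a b : cs_sort),
    cs_mul (k *: a) b = k *: cs_mul a b;
  cs_mulZr : forall (k : R[i]) (a b : cs_sort),
    cs_mul a (k *: b) = k *: cs_mul a b;
  cs_starK : involutive cs_star;
  cs_starD : forall a b : cs_sort, cs_star (a + b) = cs_star a + cs_star b;
  cs_starZ : forall (k : R[i]) (a : cs_sort),
    cs_star (k *: a) = (Num.conj k) *: cs_star a;
  cs_starM : forall a b : cs_sort,
    cs_star (cs_mul a b) = cs_mul (cs_star b) (cs_star a);
  cs_normM : forall a b : cs_sort, `|cs_mul a b| <= `|a| * `|b|;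
  cs_normC : forall a : cs_sort, `|cs_mul (cs_star a) a| = `|a| ^+ 2
}.

Definition cs_positive (R : realType) (A : cstarAlgebra R) (a : A) : Prop :=
  exists b : A, a = cs_mul (cs_star b) b.

(* The last two clauses say that the operator norm of omega, i.e. the least
   constant c with |omega a| <= c |a| for all a, is equal to 1. *)
Definition is_state (R : realType) (A : cstarAlgebra R)
    (omega : {scalar A}) : Prop :=
  [/\ forall a : A, cs_positive a -> 0 <= omega a,
      forall a : A, `|omega a| <= `|a|
    & forall c : R, (forall a : A, `|omega a| <= c%:C * `|a|) -> 1 <= c].

(* Norms take their values in R[i]; hm_normE is |x| = |<x,x>|^(1/2), and it
   entails that the inner product is definite. *)
Record hilbertModule (R : realType) (A : cstarAlgebra R) := HilbertModule {
  hm_sort :> completeNormedModType R[i];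
  hm_act : hm_sort -> A -> hm_sort;
  hm_inner : hm_sort -> hm_sort -> A;
  hm_actDl : forall (x y : hm_sort) (a : A),
    hm_act (x + y) a = hm_act x a + hm_act y a;
  hm_actDr : forall (x : hm_sort) (a b : A),
    hm_act x (a + b) = hm_act x a + hm_act x b;
  hm_actM : forall (x : hm_sort) (a b : A),
    hm_act x (cs_mul a b) = hm_act (hm_act x a) b;
  hm_actZl : forall (k : R[i]) (x : hm_sort) (a : A),
    hm_act (k *: x) a = k *: hm_act x a;
  hm_actZr : forall (k : R[i]) (x : hm_sort) (a : A),
    hm_act x (k *: a) = k *: hm_act x a;
  hm_innerD : forall x y z : hm_sort,
    hm_inner x (y + z) = hm_inner x y + hm_inner x z;
  hm_innerZ : forall (k : R[i]) (x y : hm_sort),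
    hm_inner x (k *: y) = k *: hm_inner x y;
  hm_innerM : forall (x y : hm_sort) (a : A),
    hm_inner x (hm_act y a) = cs_mul (hm_inner x y) a;
  hm_inner_star : forall x y : hm_sort,
    cs_star (hm_inner x y) = hm_inner y x;
  hm_inner_ge0 : forall x : hm_sort, cs_positive (hm_inner x x);
  hm_normE : forall x : hm_sort, `|x| ^+ 2 = `|hm_inner x x|
}.

Record hilbertSpace (R : realType) := HilbertSpace {
  hs_sort :> completeNormedModType R[i];
  hs_inner : hs_sort -> hs_sort -> R[i];
  hs_innerD : forall x y z : hs_sort,
    hs_inner x (y + z) = hs_inner x y + hs_inner x z;
  hs_innerZ : forall (k : R[i]) (x y : hs_sort),
    hs_inner x (k *: y) = k * hs_inner x y;
  hs_inner_conj : forall x y : hs_sort,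
    Num.conj (hs_inner x y) = hs_inner y x;
  hs_normE : forall x : hs_sort, `|x| ^+ 2 = hs_inner x x
}.

(* A partially defined operator on E is represented by its graph, a subset of
   E * E; thus T `<=` S is the extension relation, [closed T] means that T is a
   closed operator, and the closure of a closable operator is the topological
   closure of its graph. *)
Definition functional (E : Type) (T : set (E * E)) : Prop :=
  forall x y z : E, T (x, y) -> T (x, z) -> y = z.

Definition op_dom (E : Type) (T : set (E * E)) : set E :=
  [set x | exists y : E, T (x, y)].

(* [ip] is an A-valued or a complex-valued inner product; the relation is the
   graph of an operator as soon as op_dom T is dense. *)
Definition op_adjoint (E V : Type) (ip : E -> E -> V) (T : set (E * E)) :
    set (E * E) :=
  [set yz | forall x w : E, T (x, w) -> ip w yz.1 = ip x yz.2].

Definition subspace (K : numFieldType) (E : lmodType K) (D : set E) : Prop :=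
  [/\ D 0, forall x y : E, D x -> D y -> D (x + y)
    & forall (k : K) (x : E), D x -> D (k *: x)].

Section HilbertModuleOperators.
Variables (R : realType) (A : cstarAlgebra R) (E : hilbertModule A).
Implicit Type T : set (E * E).

Definition submodule (D : set E) : Prop :=
  subspace D /\ forall (x : E) (a : A), D x -> D (hm_act x a).

(* No linearity is required: it is automatic for semiregular operators. *)
Definition densely_defined T : Prop :=
  [/\ functional T, submodule (op_dom T) & dense (op_dom T)].

Definition adjoint T : set (E * E) := op_adjoint (@hm_inner R A E) T.

Definition semiregular T : Prop :=
  densely_defined T /\ dense (op_dom (adjoint T)).

Definition symmetric_op T : Prop := densely_defined T /\ T `<=` adjoint T.

Definition selfadjoint T : Prop := densely_defined T /\ T = adjoint T.

(* The set in the last clause is the range of I + T^* T. *)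
Definition regular T : Prop :=
  [/\ semiregular T, closed T
    & dense [set u : E | exists x y z : E,
        [/\ T (x, y), adjoint T (y, z) & u = x + z]]].

End HilbertModuleOperators.

Definition hs_selfadjoint (R : realType) (H : hilbertSpace R)
    (S : set (H * H)) : Prop :=
  [/\ functional S, subspace (op_dom S), dense (op_dom S)
    & S = op_adjoint (@hs_inner R H) S].

Section Localization.
Variables (R : realType) (A : cstarAlgebra R) (E : hilbertModule A).

(* The completion of E / N_omega, characterized up to a unique unitary
   commuting with the maps from E: a Hilbert space with a linear map
   iota : E -> E^omega of dense range that carries <.,.>_omega to the inner
   product, so that its kernel is N_omega. *)
Record localizationSpace (omega : {scalar A}) := LocalizationSpace {
  loc_space :> hilbertSpace R;
  loc_map : {linear E -> loc_space};
  loc_innerE : forall x y : E,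
    hs_inner (loc_map x) (loc_map y) = omega (hm_inner x y);
  loc_dense : dense (range loc_map)
}.

Definition localization (omega : {scalar A}) (L : localizationSpace omega)
    (T : set (E * E)) : set (L * L) :=
  closure [set (loc_map L xy.1, loc_map L xy.2) | xy in T].

End Localization.

Arguments localizationSpace {R A} E omega.
Arguments localization {R A E omega} L T.

(* Main.v *)
Require Import Defs.
From HB Require Import structures.
From mathcomp Require Import all_boot all_order all_algebra.
From mathcomp Require Import complex.
From mathcomp Require Import all_classical all_reals all_analysis.
From mathcomp Require Import ring lra.

(** Why the local-global principle holds.

    A closed symmetric operator [T] is selfadjoint and regular if and only if
    the ranges of [T + i] and [T - i] are dense.  On the one hand the identity
    [1 + T^2 = (T + i) (T - i)] gives dense ranges from regularity.  On the
    other hand [T + i] and [T - i] are bounded below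
    ([resolvent_bound]), so that dense ranges are everything, [T] has no proper
    symmetric extension, and [1 + T^2] is onto.  The same criterion applies in a
    Hilbert space ([selfadjoint_of_dense_ranges] covers both cases).

    From [T] to its localizations, density of the ranges is inherited because
    the map from [E] to its localization is contractive with dense range.

    Conversely, suppose that every localization is selfadjoint but that
    [T + i], say, has a range [M] at a distance [d > 0] from some [x0].  It is
    enough to find one state [omega] and [c > 0] with
    [omega <x0 - m, x0 - m> >= c] for all [m] in [M]: then the image of [x0] in
    the localization at [omega] is not in the closure of the range of
    [T^omega + i], although a selfadjoint operator has dense ranges
    ([hs_dense_of_orthogonal]).  This separation ([state_separation]) is a
    Hahn-Banach argument in the algebra itself, not in the module: up to adding
    positive elements the set of all [<x0 - m, x0 - m>] is convex
    ([hm_inner_convex]), and it stays away from [0] because the norm is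
    monotone on positive elements.  M. Riesz extension ([epicone_functional])
    yields a real functional that is positive on positive elements and at least
    [d^2] on this set; it is the real part of a multiple of a state.

    The separation needs the order of a C*-algebra, in which positive elements
    are by definition of the form [b^* b].  The order is defined here by norm
    inequalities in the unitization ([upper]): [h <= s] means
    [|t + h| <= t + s] asymptotically for large [t].  Two facts are needed: the
    norm of a positive element is its least upper bound ([nu_le_upper]), and
    [- b^* b <= 0] ([upper_star_mul]).  Both follow, without spectral theory,
    from approximate square roots obtained by the iteration
    [s -> (z + s^2) / 2], in which all estimates are compared with the scalar
    iteration ([approx_sqrt]).

    For the converse to have content, localizations must exist: the
    completion of [E] modulo the null space of [omega] is built as a space of
    antilinear functions on [E] ([localizationSpace_exists]). *)

Set Implicit Arguments.
Unset Strict Implicit.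
Unset Printing Implicit Defensive.

Import Order.TTheory GRing.Theory Num.Theory.
Import numFieldNormedType.Exports.

Local Open Scope classical_set_scope.
Local Open Scope ring_scope.
Local Open Scope complex_scope.

(** * Real-valued norms and complex scalars *)

Section RealNorm.
Variables (R : realType) (V : normedZmodType R[i]).
Implicit Types x y : V.

(** The norms of the structures over [R[i]] are complex-valued; their order is
    only partial, so that estimates are carried out on the real part. *)
Definition rnorm x : R := complex.Re `|x|.

Lemma rnormE x : `|x| = (rnorm x)%:C.
Proof. by rewrite /rnorm RRe_real // ger0_real. Qed.

Lemma rnorm_ge0 x : 0 <= rnorm x.
Proof. by rewrite -ler0c -rnormE. Qed.

Lemma rnormD x y : rnorm (x + y) <= rnorm x + rnorm y.
Proof. by rewrite -lecR rmorphD /= -!rnormE ler_normD. Qed.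

Lemma rnormN x : rnorm (- x) = rnorm x.
Proof. by rewrite /rnorm normrN. Qed.

Lemma rnorm0 : rnorm (0 : V) = 0.
Proof. by rewrite /rnorm normr0. Qed.

Lemma rnormB x y : rnorm (x - y) = rnorm (y - x).
Proof. by rewrite /rnorm distrC. Qed.

Lemma rnorm_eq0 x : rnorm x = 0 -> x = 0.
Proof. by move=> x0; apply/normr0_eq0; rewrite rnormE x0. Qed.

End RealNorm.

Section ComplexNorm.
Variable R : realType.
Implicit Types (r s : R) (k l : R[i]) (n : nat).

Lemma conjcE k : Num.conj k = conjc k.
Proof. by []. Qed.

Lemma realcD r s : (r + s)%:C = r%:C + s%:C :> R[i].
Proof. exact: rmorphD. Qed.

Lemma realcN r : (- r)%:C = - r%:C :> R[i].
Proof. exact: rmorphN. Qed.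

Lemma realcM r s : (r * s)%:C = r%:C * s%:C :> R[i].
Proof. exact: rmorphM. Qed.

Lemma realcV r : (r^-1)%:C = (r%:C)^-1 :> R[i].
Proof. exact: fmorphV. Qed.

Lemma realc1 : 1%:C = 1 :> R[i].
Proof. by []. Qed.

Lemma realc0 : 0%:C = 0 :> R[i].
Proof. by []. Qed.

Lemma realc_nat n : n%:R%:C = n%:R :> R[i].
Proof. exact: rmorph_nat. Qed.

Definition realcE :=
  (realcD, realcN, realcM, realcV, realc1, realc0, realc_nat).

Lemma rnorm_real r : rnorm (r%:C : R[i]) = `|r|.
Proof. by rewrite /rnorm normc_def /= expr0n addr0 sqrtr_sqr. Qed.

Lemma rnormM k l : rnorm (k * l) = rnorm k * rnorm l.
Proof. by apply/complexI; rewrite rmorphM /= -!rnormE normrM. Qed.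

Lemma rnorm1 : rnorm (1 : R[i]) = 1.
Proof. by rewrite -[1]/(1%:C) rnorm_real normr1. Qed.

Lemma mulii : 'i * 'i = - 1 :> R[i].
Proof. by rewrite -expr2 sqr_i. Qed.

Lemma conjci : conjc 'i = - 'i :> R[i].
Proof. by apply/eqP; rewrite eq_complex /= oppr0 !eqxx. Qed.

Lemma conjcM k l : conjc (k * l) = conjc k * conjc l.
Proof. exact: rmorphM. Qed.

Lemma conjcD k l : conjc (k + l) = conjc k + conjc l.
Proof. exact: rmorphD. Qed.

Lemma conjcN k : conjc (- k) = - conjc k.
Proof. exact: rmorphN. Qed.

Lemma rnorm_conj k : rnorm (conjc k) = rnorm k.
Proof. by rewrite /rnorm normcJ. Qed.

Lemma rnormi : rnorm ('i : R[i]) = 1.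
Proof. by rewrite /rnorm normc_def /= expr0n expr1n add0r sqrtr1. Qed.

Lemma rnormV k : rnorm k^-1 = (rnorm k)^-1.
Proof.
have [->|k0] := eqVneq k 0; first by rewrite invr0 rnorm0 invr0.
have rk : rnorm k != 0 by apply: contra k0 => /eqP/rnorm_eq0 ->.
by apply: (mulfI rk); rewrite -rnormM !mulfV // rnorm1.
Qed.

Lemma rnorm_gt0 k : k != 0 -> 0 < rnorm k.
Proof.
move=> k0; rewrite lt_neqAle rnorm_ge0 andbT eq_sym; apply: contra k0.
by move=> /eqP/rnorm_eq0 ->.
Qed.

Lemma rnorm_sqrtN1 k : k * k = -1 -> rnorm k = 1.
Proof.
move=> kk; have : rnorm k ^+ 2 == 1 ^+ 2.
  by rewrite expr2 -rnormM kk rnormN rnorm1 expr1n.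
by rewrite eqrXn2 ?rnorm_ge0 // => /eqP.
Qed.

Lemma rnorm_le_ReIm k : rnorm k <= `|complex.Re k| + `|complex.Im k|.
Proof.
rewrite {1}[k]complexE; apply: le_trans (rnormD _ _) _.
by rewrite rnormM rnormi mul1r !rnorm_real.
Qed.

Lemma Re_norm_le k : `|complex.Re k| <= rnorm k.
Proof. by rewrite -lecR -rnormE normc_ge_Re. Qed.

Lemma Im_norm_le k : `|complex.Im k| <= rnorm k.
Proof.
by rewrite -[rnorm k]mulr1 -rnormi -rnormM -normrN -ReiNIm Re_norm_le.
Qed.

Lemma rnormZ (V : normedModType R[i]) k (x : V) :
  rnorm (k *: x) = rnorm k * rnorm x.
Proof. by apply/complexI; rewrite rmorphM /= -!rnormE normrZ. Qed.

End ComplexNorm.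

(** * Linear identities by reflection *)

(** The syntax of linear combinations over atoms numbered by an environment;
    two of them are equal as soon as the coefficients of each atom agree. *)
Inductive lin_expr (K : Type) : Type :=
  | LinVar of nat
  | LinZero
  | LinAdd of lin_expr K & lin_expr K
  | LinOpp of lin_expr K
  | LinScale of K & lin_expr K
  | LinMuln of lin_expr K & nat.

Section LinExpr.
Variables (K : pzRingType) (V : lmodType K).

Fixpoint lin_eval (env : seq V) (e : lin_expr K) : V :=
  match e with
  | LinVar n => nth 0 env n
  | LinZero => 0
  | LinAdd e1 e2 => lin_eval env e1 + lin_eval env e2
  | LinOpp e1 => - lin_eval env e1
  | LinScale k e1 => k *: lin_eval env e1
  | LinMuln e1 n => lin_eval env e1 *+ n
  end.

Fixpoint lin_coef (e : lin_expr K) (i : nat) : K :=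
  match e with
  | LinVar n => if eqn n i then 1 else 0
  | LinZero => 0
  | LinAdd e1 e2 => lin_coef e1 i + lin_coef e2 i
  | LinOpp e1 => - lin_coef e1 i
  | LinScale k e1 => k * lin_coef e1 i
  | LinMuln e1 n => lin_coef e1 i *+ n
  end.

Fixpoint lin_same (e1 e2 : lin_expr K) (n : nat) : Prop :=
  if n is n'.+1 then lin_coef e1 n' = lin_coef e2 n' /\ lin_same e1 e2 n'
  else True.

Lemma lin_evalE env e :
  lin_eval env e = \sum_(i < size env) lin_coef e i *: nth 0 env i.
Proof.
elim: e => /= [n||e1 -> e2 ->|e1 ->|k e1 ->|e1 -> n].
- have [ltn|gen] := ltnP n (size env).
    rewrite (bigD1 (Ordinal ltn)) //= -[eqn n n]/(n == n) eqxx scale1r.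
    rewrite big1 ?addr0 // => i; rewrite -[eqn n i]/(n == i) -val_eqE /= eq_sym.
    by move=> /negPf ->; rewrite scale0r.
  rewrite nth_default // big1 // => i _; rewrite -[eqn n i]/(n == i :> nat).
  by rewrite gtn_eqF ?scale0r // (leq_trans (ltn_ord i)).
- by rewrite big1 // => i _; rewrite scale0r.
- by rewrite -big_split; apply: eq_bigr => i _; rewrite scalerDl.
- by rewrite -sumrN; apply: eq_bigr => i _; rewrite scaleNr.
- by rewrite scaler_sumr; apply: eq_bigr => i _; rewrite scalerA.
- by rewrite -sumrMnl; apply: eq_bigr => i _; rewrite scalerMnl.
Qed.

Lemma lin_same_eval env e1 e2 :
  lin_same e1 e2 (size env) -> lin_eval env e1 = lin_eval env e2.
Proof.
move=> same; rewrite !lin_evalE; apply: eq_bigr => i _; congr (_ *: _).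
case: i => i /=; move: (size env) same => n.
elim: n => //= n IHn [eqn sub]; rewrite ltnS leq_eqVlt => /orP[/eqP->//|].
exact: IHn.
Qed.

End LinExpr.

(* Atoms are compared up to conversion: equal words may carry different but
   convertible instances of the algebraic structures. *)
Ltac lin_index x l :=
  match l with
  | ?y :: _ => let _ := constr:(erefl x : x = y) in constr:(0%N)
  | _ :: ?l' => let n := lin_index x l' in constr:(S n)
  end.

Ltac lin_insert x l :=
  match l with
  | nil => constr:(cons x nil)
  | ?y :: _ => let _ := constr:(erefl x : x = y) in l
  | ?y :: ?l' => let l'' := lin_insert x l' in constr:(cons y l'')
  end.

Ltac lin_atoms e l :=
  lazymatch e with
  | 0 => l
  | ?e1 + ?e2 => let l1 := lin_atoms e1 l in lin_atoms e2 l1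
  | - ?e1 => lin_atoms e1 l
  | _ *: ?e1 => lin_atoms e1 l
  | ?e1 *+ _ => lin_atoms e1 l
  | _ => lin_insert e l
  end.

Ltac lin_quote K e l :=
  lazymatch e with
  | 0 => constr:(LinZero K)
  | ?e1 + ?e2 =>
    let q1 := lin_quote K e1 l in let q2 := lin_quote K e2 l in
    constr:(LinAdd q1 q2)
  | - ?e1 => let q1 := lin_quote K e1 l in constr:(LinOpp q1)
  | ?k *: ?e1 =>
    let q1 := lin_quote K e1 l in constr:(@LinScale K k q1)
  | ?e1 *+ ?n => let q1 := lin_quote K e1 l in constr:(LinMuln q1 n)
  | _ => let n := lin_index e l in constr:(LinVar K n)
  end.

(** [module_eq V] proves an identity between linear combinations in the module
    [V] by comparing the coefficients of each atom with [ring]. *)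
Ltac module_eq_in V :=
  lazymatch type of V with
  | GRing.Lmodule.type ?K =>
    match goal with
    | |- ?e1 = ?e2 =>
      let l1 := lin_atoms e1 (@nil (GRing.Lmodule.sort V)) in
      let l := lin_atoms e2 l1 in
      let q1 := lin_quote (GRing.PzRing.sort K) e1 l in
      let q2 := lin_quote (GRing.PzRing.sort K) e2 l in
      apply: (@lin_same_eval K V l q1 q2);
      cbn [lin_same lin_coef eqn size]; repeat split; try ring
    end
  end.
Tactic Notation "module_eq" constr(V) :=
  let V' := constr:(V : lmodType _) in
  let V'' := eval cbv [reverse_coercion] in V' in module_eq_in V''.

(** Expands products in an algebra into linear combinations of words. *)
Ltac expand_mul :=
  repeat progress (rewrite -?(scalerAl, scalerAr);
    rewrite ?(mulrDl, mulrDr, mulNr, mulrN, mul1r, mulr1, mul0r, mulr0, mulrA)).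

(** * Order and positivity for a C*-seminorm *)

(** The seminorm may have a kernel, as it does on the unitization of an algebra
    that is already unital. *)
Record cstar_seminorm (R : realType) (U : algType R[i]) (star : U -> U)
    (nu : U -> R) : Prop := CstarSeminorm {
  sn_starK : involutive star;
  sn_starD : forall x y, star (x + y) = star x + star y;
  sn_starZ : forall k x, star (k *: x) = conjc k *: star x;
  sn_starM : forall x y, star (x * y) = star y * star x;
  sn_normD : forall x y, nu (x + y) <= nu x + nu y;
  sn_normZ : forall k x, nu (k *: x) = rnorm k * nu x;
  sn_normM : forall x y, nu (x * y) <= nu x * nu y;
  sn_norm1 : nu 1 <= 1;
  sn_normC : forall x, nu x ^+ 2 <= nu (star x * x)
}.

Section CstarSeminorm.
Variables (R : realType) (U : algType R[i]) (star : U -> U) (nu : U -> R).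
Hypothesis sn : cstar_seminorm star nu.
Implicit Types (x y z h : U) (r s t : R).

Local Notation sc t := (t%:C%:A : U).

Let starK := sn_starK sn.
Let starD := sn_starD sn.
Let starZ := sn_starZ sn.
Let starM := sn_starM sn.
Let nuD := sn_normD sn.
Let nuZ := sn_normZ sn.
Let nuM := sn_normM sn.
Let nu1 := sn_norm1 sn.
Let nuC := sn_normC sn.

Lemma star0 : star 0 = 0.
Proof. by apply: (addIr (star 0)); rewrite -starD !add0r. Qed.

Lemma starN x : star (- x) = - star x.
Proof. by apply: (addIr (star x)); rewrite -starD !addNr star0. Qed.

Lemma star1 : star 1 = 1.
Proof. by rewrite -[LHS]mulr1 -[X in _ * X]starK -starM mulr1 starK. Qed.

Lemma starZr r x : star (r%:C *: x) = r%:C *: star x.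
Proof. by rewrite starZ conjc_real. Qed.

Lemma star_sc t : star (sc t) = sc t.
Proof. by rewrite starZr star1. Qed.

Lemma nu0 : nu 0 = 0.
Proof. by rewrite -(scale0r (0 : U)) nuZ rnorm0 mul0r. Qed.

Lemma nuZr r x : nu (r%:C *: x) = `|r| * nu x.
Proof. by rewrite nuZ rnorm_real. Qed.

Lemma nuN x : nu (- x) = nu x.
Proof. by rewrite -scaleN1r nuZ rnormN (rnorm_real 1) normr1 mul1r. Qed.

Lemma nu_ge0 x : 0 <= nu x.
Proof. by have := nuD x (- x); rewrite subrr nu0 nuN; lra. Qed.

Lemma nuB x y : nu (x - y) <= nu x + nu y.
Proof. by rewrite -(nuN y) nuD. Qed.

Lemma nu_le_sub x y : nu x <= nu y + nu (x - y).
Proof. by have := nuD y (x - y); rewrite addrCA subrr addr0. Qed.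

Lemma nu_sc t : nu (sc t) <= `|t|.
Proof. by rewrite nuZr ler_piMr. Qed.

Lemma nu_star_le x : nu x <= nu (star x).
Proof.
have [->|x0] := eqVneq (nu x) 0; first exact: nu_ge0.
have x_gt0 : 0 < nu x by rewrite lt_neqAle eq_sym x0 nu_ge0.
rewrite -(ler_pM2r x_gt0) -expr2; exact: le_trans (nuC x) (nuM _ _).
Qed.

Lemma nu_star x : nu (star x) = nu x.
Proof.
by apply/eqP; rewrite eq_le nu_star_le andbT -{2}(starK x) nu_star_le.
Qed.

Lemma nu_sqr x : star x = x -> nu (x * x) = nu x ^+ 2.
Proof.
move=> sx; apply/eqP; rewrite eq_le expr2 nuM /= -expr2.
by have := nuC x; rewrite sx.
Qed.

(** The order relation [h <= s] for selfadjoint [h], read off the seminorm: the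
    largest spectral value of [h] is the limit of [|t + h| - t] as [t] grows,
    and this difference is nonincreasing in [t]. *)
Definition upper h s :=
  forall e, 0 < e -> exists2 t, 0 <= t & nu (sc t + h) <= t + s + e.

Lemma upper_nu h : upper h (nu h).
Proof. by move=> e e0; exists 0 => //; rewrite scale0r !add0r lerDl ltW. Qed.

Lemma upper_weaken h s s' : s <= s' -> upper h s -> upper h s'.
Proof.
move=> ss' hs e e0; have [t t0 ht] := hs _ e0.
by exists t => //; apply: le_trans ht _; rewrite lerD2r lerD2l.
Qed.

Lemma upperD h k s s' : upper h s -> upper k s' -> upper (h + k) (s + s').
Proof.
move=> hs ks e e0; have e20 : 0 < e / 2 by lra.
have [t t0 ht] := hs _ e20; have [t' t'0 kt'] := ks _ e20.
exists (t + t'); first exact: addr_ge0.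
have -> : sc (t + t') + (h + k) = (sc t + h) + (sc t' + k).
  by rewrite !realcE; module_eq U.
apply: le_trans (nuD _ _) _; lra.
Qed.

Lemma upperZ r h s : 0 <= r -> upper h s -> upper (r%:C *: h) (r * s).
Proof.
rewrite le_eqVlt => /orP[/eqP<- _|r0 hs] e e0.
  by exists 0 => //; rewrite !realcE !scale0r addr0 nu0; lra.
have [t t0 ht] := hs _ (divr_gt0 e0 r0).
exists (r * t); first by rewrite mulr_ge0 // ltW.
have -> : sc (r * t) + r%:C *: h = r%:C *: (sc t + h).
  by rewrite !realcE; module_eq U.
rewrite nuZr gtr0_norm //; apply: le_trans (ler_wpM2l (ltW r0) ht) _.
by rewrite !mulrDr mulrCA divff ?gt_eqF // mulr1.
Qed.

Lemma upper_lim h s : (forall e, 0 < e -> upper h (s + e)) -> upper h s.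
Proof.
move=> hs e e0; have e20 : 0 < e / 2 by lra.
have [t t0 ht] := hs _ e20 _ e20; exists t => //; apply: le_trans ht _; lra.
Qed.


(** [t - h^2] is the real part of [y = t - h^2 + i s h]; the choice
    [2 t = s^2] makes [y^* y = t^2 + h^4], so that [|y|] exceeds [t] by a term
    of order [1/t]. *)
Lemma upper_sqr h : star h = h -> upper (- (h * h)) 0.
Proof.
move=> sh e e0; set K := nu h ^+ 4.
have K0 : 0 <= K by rewrite exprn_ge0 ?nu_ge0.
have [s s0 Kts] : exists2 s, 0 <= s & K <= s ^+ 2 * e.
  have Ke0 : 0 <= K / e by rewrite divr_ge0 // ltW.
  by exists (1 + K / e); [lra|rewrite -ler_pdivrMr //; nra].
have [t t0 ts] : exists2 t, 0 <= t & t * 2 = s * s.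
  by exists (s * s / 2); [rewrite divr_ge0 ?mulr_ge0|field].
exists t => //.
pose a := s%:C * 'i; pose y := sc t - h * h + a *: h.
have aa : a * a = - (t%:C * 2).
  by rewrite /a mulrACA mulii mulrN1 -realcM -ts realcM realc_nat.
have ysE : star y = sc t - h * h - a *: h.
  rewrite /y !starD starN star_sc starM starZ sh -scaleNr; congr (_ + _ *: _).
  by rewrite /a conjcM conjc_real conjci mulrN.
have yy : star y * y = sc (t * t) + h * h * (h * h).
  rewrite ysE /y !realcE; expand_mul; module_eq U.
  by transitivity (- (a * a) - t%:C * 2); [ring|rewrite aa; ring].
have ny : nu y <= t + e.
  have te0 : 0 <= t + e by lra.
  rewrite -(ler_pXn2r (n := 2)) ?nnegrE ?nu_ge0 //; apply: le_trans (nuC y) _.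
  rewrite yy; apply: le_trans (nuD _ _) _.
  apply: le_trans (lerD (nu_sc _) (nuM _ _)) _.
  rewrite ger0_norm ?mulr_ge0 // nu_sqr //.
  have -> : nu h ^+ 2 * nu h ^+ 2 = K by rewrite /K; ring.
  by nra.
have e2 : sc t + - (h * h) = (2^-1)%:C *: (y + star y).
  by rewrite ysE /y !realcE; module_eq U; field.
rewrite e2 nuZr ger0_norm ?invr_ge0 //; have := nuD y (star y); rewrite nu_star.
by lra.
Qed.

(** Since [(t + i h)^* (t + i h) = t^2 + h^2], the norm of [t + i h] exceeds [t]
    by a term of order [1/t] only. *)
Lemma upper_imaginary h : star h = h -> upper ('i *: h) 0.
Proof.
move=> sh e e0; set K := nu h ^+ 2.
have K0 : 0 <= K by rewrite exprn_ge0 ?nu_ge0.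
have [t t0 Kte] : exists2 t, 0 <= t & K <= t * 2 * e.
  exists (K / e / 2); first by rewrite !divr_ge0 // ltW.
  by rewrite divfK // divfK ?gt_eqF.
exists t => //; rewrite addr0.
rewrite -(ler_pXn2r (n := 2)) ?nnegrE ?nu_ge0 //; last by lra.
apply: le_trans (nuC _) _.
have -> : star (sc t + 'i *: h) * (sc t + 'i *: h) = sc (t * t) + h * h.
  rewrite starD star_sc starZ sh conjci !realcE; expand_mul; module_eq U.
  by transitivity (- ('i * 'i) : R[i]); [ring|rewrite mulii; ring].
apply: le_trans (nuD _ _) _; apply: le_trans (lerD (nu_sc _) (nuM _ _)) _.
rewrite ger0_norm ?mulr_ge0 // -[nu h * nu h]/K.
by clearbody K; nra.
Qed.

(** For this iteration [s_n] one has
    [(1 - s_n)^2 = 1 - z + 2 (s_(n+1) - s_n)], so that its limit would be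
    [1 - sqrt (1 - z)]. *)
Fixpoint sqrt_iter z n : U :=
  if n is m.+1 then (2^-1)%:C *: (z + sqrt_iter z m * sqrt_iter z m) else 0.

(** The same iteration at [z = 1]: it dominates the increments of [sqrt_iter z]
    when [|z| <= 1], because the iteration has nonnegative coefficients. *)
Fixpoint sqrt_iter1 n : R :=
  if n is m.+1 then (1 + sqrt_iter1 m ^+ 2) / 2 else 0.

Lemma sqrt_iter1_itv n : 0 <= sqrt_iter1 n <= 1.
Proof.
elim: n => [|n /andP[IH0 IH1]] /=; first by rewrite lexx ler01.
by apply/andP; split; nra.
Qed.

(** Twice the increment of the scalar iteration is [(1 - a_n)^2], which
    decreases; its sum up to [n] is at most [2 a_n]. *)
Lemma sqrt_iter1_rate n : n%:R * (1 - sqrt_iter1 n) ^+ 2 <= 2 * sqrt_iter1 n.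
Proof.
elim: n => [|n IH] /=; first by rewrite mul0r mulr0.
have /andP[a0 a1] := sqrt_iter1_itv n; move: (sqrt_iter1 n) a0 a1 IH => a a0 a1.
have n0 : 0 <= n%:R :> R by [].
rewrite -(natr1 n); move: (n%:R) n0 => m m0 IH.
have -> : 1 - (1 + a ^+ 2) / 2 = (1 - a) * ((1 + a) / 2) by field.
have sq1 : ((1 + a) / 2) ^+ 2 <= 1 by nra.
have q0 : 0 <= (m + 1) * (1 - a) ^+ 2 by rewrite mulr_ge0 ?sqr_ge0 //; lra.
rewrite exprMn [leLHS]mulrA; apply: le_trans (ler_wpM2l q0 sq1) _; nra.
Qed.

Lemma sqrt_iter_star z n : star z = z -> star (sqrt_iter z n) = sqrt_iter z n.
Proof.
by move=> sz; elim: n => [|n IH] /=; rewrite ?star0 // starZr starD starM IH sz.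
Qed.

Lemma sqrt_iter_comm z n w : w * z = z * w ->
  w * sqrt_iter z n = sqrt_iter z n * w.
Proof.
move=> wz; elim: n => [|n IH] /=; first by rewrite mulr0 mul0r.
rewrite -scalerAl -scalerAr mulrDl mulrDr wz; congr (_ *: (_ + _)).
by rewrite mulrA IH -mulrA IH mulrA.
Qed.

Lemma nu_sqrt_iter z n : nu z <= 1 -> nu (sqrt_iter z n) <= sqrt_iter1 n.
Proof.
move=> z1; elim: n => [|n IH] /=; first by rewrite nu0.
rewrite nuZr ger0_norm ?invr_ge0 // mulrC ler_pM2r ?invr_gt0 //.
apply: le_trans (nuD _ _) _; apply: lerD => //; apply: le_trans (nuM _ _) _.
by rewrite expr2 ler_pM ?nu_ge0.
Qed.

Lemma nu_sqrt_iterB z n : nu z <= 1 ->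
  nu (sqrt_iter z n.+1 - sqrt_iter z n) <= sqrt_iter1 n.+1 - sqrt_iter1 n.
Proof.
move=> z1; elim: n => [|n IH].
  rewrite /= mul0r addr0 subr0 nuZr ger0_norm ?invr_ge0 // expr0n addr0 subr0.
  by rewrite mul1r ler_piMr // invr_ge0.
have comm : sqrt_iter z n * sqrt_iter z n.+1 = sqrt_iter z n.+1 * sqrt_iter z n.
  by apply/esym/sqrt_iter_comm/esym/sqrt_iter_comm.
have nun := nu_sqrt_iter n z1; have nun1 := nu_sqrt_iter n.+1 z1.
have -> : sqrt_iter z n.+2 =
  (2^-1)%:C *: (z + sqrt_iter z n.+1 * sqrt_iter z n.+1) by [].
have -> : sqrt_iter1 n.+2 = (1 + sqrt_iter1 n.+1 ^+ 2) / 2 by [].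
have E1 : sqrt_iter z n.+1 = (2^-1)%:C *: (z + sqrt_iter z n * sqrt_iter z n).
  by [].
have E2 : sqrt_iter1 n.+1 = (1 + sqrt_iter1 n ^+ 2) / 2 by [].
move: comm nun nun1 IH E1 E2.
move: (sqrt_iter z n.+1) (sqrt_iter z n) (sqrt_iter1 n.+1) (sqrt_iter1 n).
move=> s' s a' a comm sa s'a' ds E1 E2.
have -> : (2^-1)%:C *: (z + s' * s') - s' = (2^-1)%:C *: ((s' - s) * (s' + s)).
  by rewrite {3}E1; expand_mul; rewrite comm; module_eq U.
rewrite nuZr ger0_norm ?invr_ge0 //.
have -> : (1 + a' ^+ 2) / 2 - a' = 2^-1 * ((a' - a) * (a' + a)).
  by rewrite {2}E2; field.
rewrite ler_pM2l ?invr_gt0 //; apply: le_trans (nuM _ _) _.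
by apply: ler_pM; rewrite ?nu_ge0 //; apply: le_trans (nuD _ _) _; apply: lerD.
Qed.

(** The hypothesis says [0 <= x <= 2 T].  The root is
    [sqrt T (1 - s_n)] with [z = 1 - x / T]; that it commutes with whatever
    commutes with [x], and is again positive, allows roots to be iterated and
    combined. *)
Lemma approx_sqrt x T e : star x = x -> 0 < T -> nu (sc T - x) <= T -> 0 < e ->
  exists y, [/\ star y = y, forall w, w * x = x * w -> w * y = y * w,
    nu (y * y - x) <= e & nu (sc (Num.sqrt T) - y) <= Num.sqrt T].
Proof.
move=> sx T0 xT e0; pose z := (T^-1)%:C *: (sc T - x).
have sz : star z = z by rewrite starZr starD starN star_sc sx.
have nz : nu z <= 1.
  by rewrite nuZr gtr0_norm ?invr_gt0 // mulrC ler_pdivrMr // mul1r.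
have TU : T%:C \is a GRing.unit
  by rewrite unitfE (inj_eq (@complexI R) T 0) gt_eqF.
have Tz : T%:C *: (1 - z) = x.
  rewrite /z scalerBr scalerA -realcM divff ?gt_eqF // realc1; module_eq U.
have [n n_gt] : exists n : nat, 2 * T / e < n%:R.
  by exists (Num.truncn (2 * T / e)).+1; apply: truncnS_gt.
exists ((Num.sqrt T)%:C *: (1 - sqrt_iter z n)).
have sqT : (Num.sqrt T)%:C * (Num.sqrt T)%:C = T%:C.
  by rewrite -realcM -expr2 sqr_sqrtr // ltW.
split.
- by rewrite starZr starD starN star1 sqrt_iter_star.
- move=> w wx; rewrite -scalerAl -scalerAr mulrBr mulrBl mulr1 mul1r.
  rewrite sqrt_iter_comm // /z -scalerAl -scalerAr mulrBr mulrBl wx.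
  by rewrite -scalerAl -scalerAr mulr1 mul1r.
- have -> : (Num.sqrt T)%:C *: (1 - sqrt_iter z n) *
      ((Num.sqrt T)%:C *: (1 - sqrt_iter z n)) - x =
      T%:C *: ((sqrt_iter z n.+1 - sqrt_iter z n) *+ 2).
    rewrite -[X in _ - X]Tz -sqT /=; expand_mul.
    by module_eq U; rewrite !realcE; field.
  rewrite nuZr gtr0_norm // mulrC -ler_pdivlMr //.
  have := nu_sqrt_iterB n nz; have := sqrt_iter1_rate n;
    rewrite [sqrt_iter1 n.+1]/=.
  have /andP[] := sqrt_iter1_itv n; move: (sqrt_iter1 n) => a a0 a1 ra.
  move=> da; rewrite mulr2n; apply: le_trans (nuD _ _) _.
  have -> : e / T = 2 / (2 * T / e) by field; rewrite !gt_eqF.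
  have TT : 0 < 2 * T / e by rewrite divr_gt0 // mulr_gt0.
  have : (1 - a) ^+ 2 <= 2 / n%:R.
    by rewrite ler_pdivlMr ?(lt_trans TT) // mulrC; lra.
  have : 2 / n%:R <= 2 / (2 * T / e).
    by rewrite ler_pM2l // lef_pV2 ?posrE // ?ltW // (lt_trans TT).
  by lra.
- have -> : sc (Num.sqrt T) - (Num.sqrt T)%:C *: (1 - sqrt_iter z n) =
      (Num.sqrt T)%:C *: sqrt_iter z n by module_eq U.
  rewrite nuZr ger0_norm // ler_piMr //; apply: le_trans (nu_sqrt_iter n nz) _.
  by have /andP[] := sqrt_iter1_itv n.
Qed.
(** [y] is the real part of [y + i v], and
    [(y + i v)^* (y + i v) = y^2 + v^2]. *)
Lemma nu_sqr_le_add y v : star y = y -> star v = v -> y * v = v * y ->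
  nu (y * y) <= nu (y * y + v * v).
Proof.
move=> sy sv yv; pose w := y + 'i *: v.
have sw : star w = y - 'i *: v by rewrite starD starZ sy sv conjci scaleNr.
have -> : y * y + v * v = star w * w.
  rewrite sw /w; expand_mul; rewrite yv; module_eq U.
  by rewrite !mulr0 !mulr1 mulii; ring.
apply: le_trans (nuC w); rewrite nu_sqr // ler_pXn2r ?nnegrE ?nu_ge0 //.
have -> : y = (2^-1)%:C *: (w + star w).
  by rewrite sw /w !realcE; module_eq U; field.
rewrite nuZr ger0_norm ?invr_ge0 //.
by have := nuD w (star w); rewrite nu_star; lra.
Qed.

(** Up to small errors [h = y^2] and [s - h = v^2] with commuting roots, hence
    [|h| <= |y^2 + v^2| = s]. *)
Lemma nu_le_upper h s : star h = h -> 0 <= s -> upper (- h) 0 -> upper h s ->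
  nu h <= s.
Proof.
move=> sh s0 h_ge0 h_le; apply/ler_addgt0Pr => e' e'0.
pose e := e' / 7; have e0 : 0 < e by rewrite divr_gt0.
have [t1 t10 ht1] := h_ge0 _ e0; have [t2 t20 ht2] := h_le _ e0.
have [] := @approx_sqrt (sc e + h) (t1 + e) e; rewrite ?starD ?star_sc ?sh //.
- by lra.
- have -> : sc (t1 + e) - (sc e + h) = sc t1 - h.
    by rewrite !realcE; module_eq U.
  by move: ht1; lra.
move=> y [sy commy yy _].
have [] := @approx_sqrt (sc (s + 2 * e) - h) (t2 + s + 2 * e) e;
  rewrite ?starD ?starN ?star_sc ?sh //.
- by lra.
- have -> : sc (t2 + s + 2 * e) - (sc (s + 2 * e) - h) = sc t2 + h.
    by rewrite !realcE; module_eq U.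
  by lra.
move=> v [sv commv vv _].
have yv : y * v = v * y.
  apply: commv; apply/esym/commy; rewrite !realcE; expand_mul; module_eq U.
have nyv := nu_sqr_le_add sy sv yv.
have hE : h = (y * y) - (y * y - (sc e + h)) - sc e by module_eq U.
have yvE : y * y + v * v = (y * y - (sc e + h)) +
    (v * v - (sc (s + 2 * e) - h)) + sc (s + 3 * e).
  by rewrite !realcE; module_eq U.
have n1 : nu h <= nu (y * y) + nu (y * y - (sc e + h)) + e.
  rewrite {1}hE; apply: le_trans (nuB _ _) _; apply: lerD; first exact: nuB.
  by rewrite -[leRHS]gtr0_norm ?nu_sc.
have n2 : nu (y * y + v * v) <= e + e + (s + 3 * e).
  rewrite yvE; apply: le_trans (nuD _ _) _; apply: lerD.
    by apply: le_trans (nuD _ _) _; apply: lerD.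
  by apply: le_trans (nu_sc _) _; rewrite ger0_norm //; lra.
have e7 : e' = 7 * e by rewrite /e; field.
by lra.
Qed.

(** [r^2] is an approximation of the absolute value of [h]. *)
Lemma approx_fourth_root h e : star h = h -> 0 < e ->
  exists r : U, [/\ star r = r, r * h = h * r & nu (r * r * (r * r) - h * h)
    <= e].
Proof.
move=> sh e'0; pose e' := e / 3; have e0 : 0 < e' by rewrite divr_gt0.
have [t t0 ht] := upper_sqr sh e0; rewrite addr0 in ht.
have [] := @approx_sqrt (sc e' + h * h) (t + e') e';
  rewrite ?starD ?starM ?star_sc ?sh //.
- by lra.
- have -> : sc (t + e') - (sc e' + h * h) = sc t + - (h * h).
    by rewrite !realcE; module_eq U.
  by [].
move=> y [sy commy yy sqy].
have ny := nu_ge0 y.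
pose d := Num.min 1 (e' / (1 + 2 * nu y)).
have d0 : 0 < d by rewrite lt_min ltr01 divr_gt0 //; lra.
have d1 : d <= 1 by rewrite ge_min lexx.
have dy : d * (1 + 2 * nu y) <= e'.
  by rewrite -ler_pdivlMr ?ge_min ?lexx ?orbT //; lra.
have sT0 : 0 < Num.sqrt (t + e') by rewrite sqrtr_gt0; lra.
have [r [sr commr rr _]] := approx_sqrt sy sT0 sqy d0.
exists r; split=> //.
  apply/esym/commr/commy; expand_mul; module_eq U.
have -> : r * r * (r * r) - h * h = (r * r - y) * (r * r - y) +
    ((r * r - y) * y + y * (r * r - y)) + (y * y - (sc e' + h * h)) + sc e'.
  by expand_mul; module_eq U.
have n0 := nu_ge0 (r * r - y).
have b1 : nu ((r * r - y) * (r * r - y)) <= d.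
  by apply: le_trans (nuM _ _) _; nra.
have b2 : nu ((r * r - y) * y) <= d * nu y.
  by apply: le_trans (nuM _ _) _; nra.
have b3 : nu (y * (r * r - y)) <= d * nu y.
  by apply: le_trans (nuM _ _) _; nra.
have b4 : nu (sc e') <= e' by rewrite -[leRHS]gtr0_norm ?nu_sc.
have e3 : e = 3 * e' by rewrite /e'; field.
apply: le_trans (nuD _ _) _; rewrite e3.
have := nuD ((r * r - y) * (r * r - y) + ((r * r - y) * y + y * (r * r - y)))
  (y * y - (sc e' + h * h)).
have := nuD ((r * r - y) * (r * r - y)) ((r * r - y) * y + y * (r * r - y)).
have := nuD ((r * r - y) * y) (y * (r * r - y)).
by lra.
Qed.

(** This section carries the proof that [h = b^* b] is positive.  Let [r] be
    selfadjoint and commute with [h], with [g = r^2] close to the absolute value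
    of [h]; then [q = g - h] is close to twice the negative part of [h], and
    [e = g^2 - h^2] is small.  For [x = q r] one finds
    [x^2 = - h q^2 + q e], and therefore [d = b x] satisfies
    [d^* d = - (h q)^2] and [d d^* = - (b q b^* )^2] up to terms with the factor
    [e].  But [d^* d + d d^*] is a sum of squares, so [h q], and with it [q],
    must be small: [h] is close to the square [r^2]. *)
Section NegativePart.
Variables b r : U.
Let h := star b * b.
Let g := r * r.
Let q := g - h.
Let e := g * g - h * h.
Let d := b * (q * r).
Let p := b * q * star b.
Let err := h * q * e + b * q * e * star b.
Hypotheses (sr : star r = r) (rh : r * h = h * r).

Let sh : star h = h. Proof. by rewrite /h starM starK. Qed.
Let sq : star q = q. Proof. by rewrite /q /g starD starN starM sr sh. Qed.
Let gh : g * h = h * g. Proof. by rewrite /g -mulrA rh mulrA rh mulrA. Qed.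
Let qh : q * h = h * q. Proof. by rewrite /q mulrBl mulrBr gh. Qed.
Let qr : q * r = r * q. Proof. by rewrite /q mulrBl mulrBr rh /g !mulrA. Qed.

Let qg : q * g = - (h * q) + e.
Proof.
have gg : g * g = e + h * h by rewrite /e subrK.
by rewrite {1}/q mulrBl gg /q mulrBr; module_eq U.
Qed.

Let qrqr : q * r * (q * r) = q * (q * g).
Proof. by rewrite -mulrA (mulrA r) -qr /g !mulrA. Qed.

Let sd : star d = q * r * star b.
Proof. by rewrite /d !starM sr sq qr. Qed.

Let dsd : star d * d = - (h * q * (h * q)) + h * q * e.
Proof.
have -> : star d * d = q * r * h * (q * r) by rewrite sd /d /h !mulrA.
have -> : q * r * h * (q * r) = h * (q * r * (q * r)).
  by rewrite -(mulrA q) rh (mulrA q) qh !mulrA.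
by rewrite qrqr mulrA qg mulrDr mulrN.
Qed.

Let dds : d * star d = - (p * p) + b * q * e * star b.
Proof.
have -> : d * star d = b * (q * r * (q * r)) * star b by rewrite sd /d !mulrA.
rewrite qrqr qg (mulrDr q) (mulrDr b) mulrDl (mulrN q) mulrN mulNr.
congr (- _ + _); last first.
  by rewrite !mulrA.
by rewrite /p /h !mulrA.
Qed.

Let re := d + star d.
Let im := 'i *: (d - star d).

(* Both [d^* d] and [d d^*] are negative up to [err], while their sum is half
   of [re^2 + im^2]. *)
Let squares_eq :
  h * q * (h * q) = - (p * p) + ((2^-1)%:C *: - (re * re) +
                    (2^-1)%:C *: - (im * im)) + err.
Proof.
have -> : h * q * (h * q) = - (star d * d) + h * q * e.
  by rewrite dsd; module_eq U.
have -> : - (p * p) = d * star d - b * q * e * star b.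
  by rewrite dds; module_eq U.
have -> : im * im = - ((d - star d) * (d - star d)).
  by rewrite /im -scalerAl -scalerAr scalerA mulii scaleN1r.
by rewrite /re /err; expand_mul; module_eq U; rewrite !realcE; field.
Qed.

Let shq : star (h * q) = h * q. Proof. by rewrite starM sq sh qh. Qed.

Lemma nu_hq : nu (h * q) ^+ 2 <= nu err.
Proof.
have spp : star p = p by rewrite /p !starM starK sq mulrA.
have sre : star re = re by rewrite /re starD starK addrC.
have sim : star im = im.
  by rewrite /im starZ starD starN starK conjci; module_eq U.
rewrite -(nu_sqr shq).
apply: nu_le_upper; [by rewrite starM shq|exact: nu_ge0|exact: upper_sqr|].
rewrite [X in upper X]squares_eq -[nu err]add0r; apply: upperD; last first.
  exact: upper_nu.
rewrite -[0](addr0 0); apply: upperD; first exact: upper_sqr.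
rewrite -[0](addr0 0); apply: upperD; rewrite -(mulr0 2^-1);
  by apply: upperZ; rewrite ?invr_ge0 //; exact: upper_sqr.
Qed.

Lemma upper_negative_part e' : 0 < e' <= 1 -> nu e <= e' ->
  let K := nu b ^+ 2 in
  exists2 s, upper (- h) s &
    s ^+ 2 <= e' + 2 * Num.sqrt (2 * K * (2 * K + 1) * e').
Proof.
move=> /andP[e'0 e'1] ee' K; have K0 : 0 <= K by rewrite exprn_ge0 ?nu_ge0.
have nh : nu h <= K by rewrite /h (le_trans (nuM _ _)) // nu_star.
have ng : nu g <= K + 1.
  have sg : star g = g by rewrite /g starM sr.
  rewrite -(ler_pXn2r (n := 2)) ?nnegrE ?nu_ge0 //; last by lra.
  rewrite -nu_sqr // (le_trans (nu_le_sub _ (h * h))) //.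
  by have := nuM h h; have := nu_ge0 h; rewrite -/e; nra.
have nq : nu q <= 2 * K + 1 by apply: le_trans (nuB _ _) _; lra.
have nerr : nu err <= 2 * K * (2 * K + 1) * e'.
  apply: le_trans (nuD _ _) _.
  have n1 : nu (h * q * e) <= K * (2 * K + 1) * e'.
    apply: le_trans (nuM _ _) _; apply: ler_pM; rewrite ?nu_ge0 //.
    by apply: le_trans (nuM _ _) _; apply: ler_pM; rewrite ?nu_ge0.
  have n2 : nu (b * q * e * star b) <= nu b * (2 * K + 1) * e' * nu b.
    apply: le_trans (nuM _ _) _; apply: ler_pM; rewrite ?nu_ge0 ?nu_star //.
    apply: le_trans (nuM _ _) _; apply: ler_pM; rewrite ?nu_ge0 //.
    by apply: le_trans (nuM _ _) _; apply: ler_pM; rewrite ?nu_ge0.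
  have -> : 2 * K * (2 * K + 1) * e' =
    K * (2 * K + 1) * e' + nu b * (2 * K + 1) * e' * nu b by rewrite /K; ring.
  exact: lerD.
exists (nu q + 0).
  have -> : - h = q + - (r * r) by rewrite /q /g; module_eq U.
  by apply: upperD; [exact: upper_nu|exact: upper_sqr].
rewrite addr0 -nu_sqr //.
have -> : q * q = e - (h * q) *+ 2.
  have -> : q * q = q * g - q * h by rewrite -mulrBr.
  by rewrite qg qh; module_eq U.
apply: le_trans (nuB _ _) _; apply: lerD => //.
have : nu (h * q) <= Num.sqrt (2 * K * (2 * K + 1) * e').
  rewrite -[leLHS]ger0_norm ?nu_ge0 // -sqrtr_sqr ler_wsqrtr //.
  exact: le_trans nu_hq nerr.
by have := nuD (h * q) (h * q); rewrite -mulr2n; lra.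
Qed.

End NegativePart.

(** Positivity of [b^* b]: the bound of [upper_negative_part] tends to zero with
    the error in the fourth root of [h^2]. *)
Lemma upper_star_mul b : upper (- (star b * b)) 0.
Proof.
apply: upper_lim => c c0.
have [K KE] : exists K, K = nu b ^+ 2 by exists (nu b ^+ 2).
have K0 : 0 <= K by rewrite KE exprn_ge0 ?nu_ge0.
have [C CE] : exists C, C = 2 * K * (2 * K + 1) by eexists.
have C0 : 0 <= C by rewrite CE; nra.
(* Both terms of the bound on [s^2] are then at most [c^2 / 2]. *)
pose e := Num.min 1 (Num.min (c ^+ 2 / 2) (c ^+ 4 / (16 * (C + 1)))).
have e0 : 0 < e.
  by rewrite !lt_min ltr01 !divr_gt0 ?exprn_gt0 //= mulr_gt0 //; lra.
have e1 : e <= 1 by rewrite ge_min lexx.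
have e2 : e <= c ^+ 2 / 2 by rewrite !ge_min lexx !orbT.
have e3 : e * (16 * (C + 1)) <= c ^+ 4.
  by rewrite -ler_pdivlMr ?ge_min ?lexx ?orbT //; lra.
clearbody e.
have [r [sr rh re]] := approx_fourth_root (h := star b * b) (e := e)
  (etrans (starM _ _) (congr1 _ (starK _))) e0.
have [|s hs sc2] := upper_negative_part sr rh (e' := e) _ re;
  first by rewrite e0.
apply: upper_weaken hs; rewrite add0r.
have sqc : Num.sqrt (C * e) <= c ^+ 2 / 4.
  have c4 : 0 <= c ^+ 2 / 4 by rewrite divr_ge0 ?sqr_ge0.
  rewrite -[leRHS]ger0_norm // -sqrtr_sqr ler_wsqrtr // exprMn -exprM.
  have -> : c ^+ (2 * 2) * 4^-1 ^+ 2 = c ^+ 4 / 16 by field.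
  by rewrite ler_pdivlMr //; nra.
rewrite /= -KE -CE in sc2.
have [s0|s0] := leP s 0; first exact: le_trans s0 (ltW c0).
rewrite -(ler_pXn2r (n := 2)) ?nnegrE //; [lra|exact: ltW|exact: ltW].
Qed.

End CstarSeminorm.

(** * The unitization *)

Section CstarAlgebraBasics.
Variables (R : realType) (A : cstarAlgebra R).
Implicit Types a b : A.

Lemma cs_mul0l a : cs_mul 0 a = 0.
Proof. by apply: (addIr (cs_mul 0 a)); rewrite -cs_mulDl !add0r. Qed.

Lemma cs_mul0r a : cs_mul a 0 = 0.
Proof. by apply: (addIr (cs_mul a 0)); rewrite -cs_mulDr !add0r. Qed.

Lemma cs_star0 : cs_star (0 : A) = 0.
Proof. by apply: (addIr (cs_star (0 : A))); rewrite -cs_starD !add0r. Qed.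

Lemma cs_starN a : cs_star (- a) = - cs_star a.
Proof. by apply: (addIr (cs_star a)); rewrite -cs_starD !addNr cs_star0. Qed.

Lemma cs_rnormM a b : rnorm (cs_mul a b) <= rnorm a * rnorm b.
Proof. by rewrite -lecR realcM -!rnormE cs_normM. Qed.

Lemma cs_rnormC a : rnorm (cs_mul (cs_star a) a) = rnorm a ^+ 2.
Proof. by apply: complexI; rewrite -rnormE cs_normC rnormE !expr2 realcM. Qed.

Lemma cs_rnorm_star a : rnorm (cs_star a) = rnorm a.
Proof.
suff le b : rnorm b <= rnorm (cs_star b).
  by apply/eqP; rewrite eq_le le andbT -{2}(cs_starK a) le.
have [->|b0] := eqVneq (rnorm b) 0; first exact: rnorm_ge0.
have b_gt0 : 0 < rnorm b by rewrite lt_neqAle eq_sym b0 rnorm_ge0.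
by rewrite -(ler_pM2r b_gt0) -expr2 -cs_rnormC cs_rnormM.
Qed.

End CstarAlgebraBasics.

(** Only a seminorm is put on it, that of the operators of left multiplication
    on [A]; it has a kernel when [A] is unital. *)
Definition unitization (R : realType) (A : cstarAlgebra R) : Type :=
  (R[i] * A)%type.

Section Unitization.
Variables (R : realType) (A : cstarAlgebra R).
Local Notation U := (unitization A).

HB.instance Definition _ := GRing.Lmodule.copy U (R[i] * A)%type.

Definition unitization_one : U := (1, 0).
Definition unitization_mul (u v : U) : U :=
  (u.1 * v.1, u.1 *: v.2 + v.1 *: u.2 + cs_mul u.2 v.2).

Lemma unitization_mulA : associative unitization_mul.
Proof.
move=> [r a] [s b] [t c]; congr (_, _) => /=; first by rewrite mulrA.
rewrite !(cs_mulDl, cs_mulDr) !(cs_mulZl, cs_mulZr) cs_mulA; module_eq A.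
Qed.

Lemma unitization_mul1 : left_id unitization_one unitization_mul.
Proof.
by move=> [r a]; congr (_, _) => /=; rewrite ?mul1r // cs_mul0l; module_eq A.
Qed.

Lemma unitization_mulr1 : right_id unitization_one unitization_mul.
Proof.
by move=> [r a]; congr (_, _) => /=; rewrite ?mulr1 // cs_mul0r; module_eq A.
Qed.

Lemma unitization_mulDl : left_distributive unitization_mul +%R.
Proof.
move=> [r a] [s b] [t c]; congr (_, _) => /=; first by rewrite mulrDl.
rewrite cs_mulDl; module_eq A.
Qed.

Lemma unitization_mulDr : right_distributive unitization_mul +%R.
Proof.
move=> [r a] [s b] [t c]; congr (_, _) => /=; first by rewrite mulrDr.
rewrite cs_mulDr; module_eq A.
Qed.

Lemma unitization_one_neq0 : unitization_one != 0.
Proof. by apply/eqP => -[/eqP]; rewrite oner_eq0. Qed.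

HB.instance Definition _ := GRing.Zmodule_isNzRing.Build U
  unitization_mulA unitization_mul1 unitization_mulr1 unitization_mulDl
  unitization_mulDr unitization_one_neq0.

Lemma unitization_scalerAl (k : R[i]) (u v : U) : k *: (u * v) = k *: u * v.
Proof.
case: u v => [r a] [s b]; congr (_, _) => /=; first by rewrite -mulrA.
rewrite cs_mulZl -[k *: r]/(k * r); module_eq A.
Qed.

HB.instance Definition _ :=
  GRing.Lmodule_isLalgebra.Build R[i] U unitization_scalerAl.

Lemma unitization_scalerAr (k : R[i]) (u v : U) : k *: (u * v) = u * (k *: v).
Proof.
case: u v => [r a] [s b]; congr (_, _) => /=; first by rewrite mulrCA.
rewrite cs_mulZr -[k *: s]/(k * s); module_eq A.
Qed.

HB.instance Definition _ :=
  GRing.Lalgebra_isAlgebra.Build R[i] U unitization_scalerAr.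

Definition unitization_star (u : U) : U := (conjc u.1, cs_star u.2).

Lemma unitization_starK : involutive unitization_star.
Proof. by case=> r a; rewrite /unitization_star /= conjcK cs_starK. Qed.

Lemma unitization_starD u v :
  unitization_star (u + v) = unitization_star u + unitization_star v.
Proof. by congr (_, _); rewrite /= (conjcD, cs_starD). Qed.

Lemma unitization_starZ (k : R[i]) (u : U) :
  unitization_star (k *: u) = conjc k *: unitization_star u.
Proof. by congr (_, _); rewrite /= (conjcM, cs_starZ). Qed.

Lemma unitization_starM (u v : U) :
  unitization_star (u * v) = unitization_star v * unitization_star u.
Proof.
congr (_, _) => /=; first by rewrite conjcM mulrC.
by rewrite !cs_starD !cs_starZ cs_starM !conjcE; module_eq A.
Qed.

Definition unitization_act (u : U) (x : A) : A := u.1 *: x + cs_mul u.2 x.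

Definition unitization_norm (u : U) : R :=
  sup [set rnorm (unitization_act u x) | x in [set x | rnorm x <= 1]].

Local Notation act := unitization_act.
Local Notation nu := unitization_norm.

Lemma unitization_actD u v x : act (u + v) x = act u x + act v x.
Proof. by rewrite /act /= cs_mulDl; module_eq A. Qed.

Lemma unitization_actZ k u x : act (k *: u) x = k *: act u x.
Proof. by rewrite /act /= cs_mulZl -[k *: u.1]/(k * u.1); module_eq A. Qed.

Lemma unitization_actM u v x : act (u * v) x = act u (act v x).
Proof.
by rewrite /act /= !(cs_mulDl, cs_mulDr, cs_mulZl, cs_mulZr) cs_mulA;
  module_eq A.
Qed.

Lemma unitization_act_scale u k x : act u (k *: x) = k *: act u x.
Proof. by rewrite /act cs_mulZr; module_eq A. Qed.

Lemma unitization_act_star u x :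
  cs_mul (cs_star (act u x)) (act u x) =
  cs_mul (cs_star x) (act (unitization_star u * u) x).
Proof.
have -> : cs_star (act u x) =
    conjc u.1 *: cs_star x + cs_mul (cs_star x) (cs_star u.2).
  by rewrite /act cs_starD cs_starZ cs_starM.
rewrite unitization_actM; move: (act u x) => y.
by rewrite /act /= cs_mulDl cs_mulDr cs_mulZl cs_mulZr cs_mulA.
Qed.

Lemma unitization_act_bound u x :
  rnorm (act u x) <= (rnorm u.1 + rnorm u.2) * rnorm x.
Proof.
apply: le_trans (rnormD _ _) _; rewrite mulrDl rnormZ lerD2l.
exact: cs_rnormM.
Qed.

Lemma unitization_norm_has_sup u :
  has_sup [set rnorm (act u x) | x in [set x | rnorm x <= 1]].
Proof.
split; first by exists (rnorm (act u 0)); exists 0 => //=; rewrite rnorm0 ler01.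
exists (rnorm u.1 + rnorm u.2) => _ [x /= x1 <-].
apply: le_trans (unitization_act_bound _ _) _.
by rewrite ler_piMr // addr_ge0 ?rnorm_ge0.
Qed.

Lemma unitization_norm_le u K : 0 <= K ->
  (forall x, rnorm (act u x) <= K * rnorm x) -> nu u <= K.
Proof.
move=> K0 uK; apply: ge_sup; first by have [] := unitization_norm_has_sup u.
by move=> _ [x /= x1 <-]; apply: le_trans (uK x) _; rewrite ler_piMr.
Qed.

Lemma unitization_norm_ge0 u : 0 <= nu u.
Proof.
apply: le_trans (rnorm_ge0 (act u 0)) _; apply: sup_upper_bound.
  exact: unitization_norm_has_sup.
by exists 0 => //=; rewrite rnorm0 ler01.
Qed.

Lemma unitization_act_le u x : rnorm (act u x) <= nu u * rnorm x.
Proof.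
have [/rnorm_eq0 ->|x0] := eqVneq (rnorm x) 0.
  by rewrite /act scaler0 cs_mul0r addr0 rnorm0 mulr0.
have x_gt0 : 0 < rnorm x by rewrite lt_neqAle eq_sym x0 rnorm_ge0.
have V0 : 0 < (rnorm x)^-1 by rewrite invr_gt0.
rewrite -ler_pdivrMr // mulrC.
have -> : (rnorm x)^-1 * rnorm (act u x) = rnorm (act u ((rnorm x)^-1%:C *: x)).
  by rewrite unitization_act_scale rnormZ rnorm_real gtr0_norm.
apply: sup_upper_bound; first exact: unitization_norm_has_sup.
exists ((rnorm x)^-1%:C *: x) => //=.
by rewrite rnormZ rnorm_real gtr0_norm // mulVf.
Qed.

Lemma unitization_normD u v : nu (u + v) <= nu u + nu v.
Proof.
apply: unitization_norm_le => [|x];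
  first by rewrite addr_ge0 ?unitization_norm_ge0.
rewrite unitization_actD mulrDl; apply: le_trans (rnormD _ _) _.
by apply: lerD; apply: unitization_act_le.
Qed.

Lemma unitization_normZ k u : nu (k *: u) = rnorm k * nu u.
Proof.
have le l v : nu (l *: v) <= rnorm l * nu v.
  apply: unitization_norm_le => [|x].
    by rewrite mulr_ge0 ?rnorm_ge0 ?unitization_norm_ge0.
  rewrite unitization_actZ rnormZ -mulrA ler_wpM2l ?rnorm_ge0 //.
  exact: unitization_act_le.
apply/eqP; rewrite eq_le le /=.
have [->|k0] := eqVneq k 0; first by rewrite rnorm0 mul0r unitization_norm_ge0.
have rk := rnorm_gt0 k0.
rewrite mulrC -ler_pdivlMr // mulrC.
rewrite -rnormV.
by rewrite -{1}(scale1r u) -(mulVf k0) -scalerA.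
Qed.

Lemma unitization_normM u v : nu (u * v) <= nu u * nu v.
Proof.
apply: unitization_norm_le => [|x];
  first by rewrite mulr_ge0 ?unitization_norm_ge0.
rewrite unitization_actM -mulrA; apply: le_trans (unitization_act_le _ _) _.
by rewrite ler_wpM2l ?unitization_norm_ge0 ?unitization_act_le.
Qed.

Lemma unitization_norm1 : nu 1 <= 1.
Proof.
apply: unitization_norm_le => // x.
by rewrite /act scale1r cs_mul0l addr0 mul1r.
Qed.

(** For [x] in [A] of norm at most [1], [|u x|^2 = |x^* (u^* u) x|]. *)
Lemma unitization_normC u : nu u ^+ 2 <= nu (unitization_star u * u).
Proof.
have n0 := unitization_norm_ge0 (unitization_star u * u).
rewrite -[leRHS]sqr_sqrtr // ler_pXn2r ?nnegrE ?unitization_norm_ge0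
  ?sqrtr_ge0 //.
apply: unitization_norm_le => // x.
rewrite -(ler_pXn2r (n := 2)) ?nnegrE ?mulr_ge0 ?rnorm_ge0 //.
rewrite -cs_rnormC unitization_act_star exprMn sqr_sqrtr //.
apply: le_trans (cs_rnormM _ _) _; rewrite cs_rnorm_star.
rewrite mulrC expr2 mulrA; apply: ler_wpM2r; rewrite ?rnorm_ge0 //.
exact: unitization_act_le.
Qed.

Lemma unitization_cstar_seminorm : cstar_seminorm unitization_star nu.
Proof.
split; [exact: unitization_starK|exact: unitization_starD|
  exact: unitization_starZ|exact: unitization_starM|exact: unitization_normD|
  exact: unitization_normZ|exact: unitization_normM|exact: unitization_norm1|
  exact: unitization_normC].
Qed.

Definition unitization_inj (a : A) : U := (0, a).

(** The lower bound is attained at [a^*]. *)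
Lemma unitization_norm_inj a : nu (unitization_inj a) = rnorm a.
Proof.
have actE x : act (unitization_inj a) x = cs_mul a x.
  by rewrite /act scale0r add0r.
apply/eqP; rewrite eq_le; apply/andP; split.
  by apply: unitization_norm_le => [|x]; rewrite ?rnorm_ge0 // actE cs_rnormM.
have [->|a0] := eqVneq (rnorm a) 0; first exact: unitization_norm_ge0.
have a_gt0 : 0 < rnorm a by rewrite lt_neqAle eq_sym a0 rnorm_ge0.
rewrite -(ler_pM2r a_gt0) -{3}cs_rnorm_star -expr2.
have := unitization_act_le (unitization_inj a) (cs_star a).
by rewrite actE -{1}[a]cs_starK cs_rnormC cs_rnorm_star.
Qed.

End Unitization.

(** * The order of a C*-algebra *)

Section CstarOrder.
Variables (R : realType) (A : cstarAlgebra R).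
Implicit Types (a b h : A) (r s t : R).

Definition cs_upper a s := upper (@unitization_norm R A) (unitization_inj a) s.

Let sn := unitization_cstar_seminorm A.

Let injD a b :
  unitization_inj (a + b) = unitization_inj a + unitization_inj b.
Proof. by congr (_, _); rewrite /= addr0. Qed.

Let injN a : unitization_inj (- a) = - unitization_inj a.
Proof. by congr (_, _); rewrite /= oppr0. Qed.

Let injZ (k : R[i]) a : unitization_inj (k *: a) = k *: unitization_inj a.
Proof. by congr (_, _); rewrite /= scaler0. Qed.

Let injM a b :
  unitization_inj (cs_mul a b) = unitization_inj a * unitization_inj b.
Proof. by congr (_, _); rewrite /= ?mulr0 // !scale0r !add0r. Qed.

Let inj_star a :
  unitization_star (unitization_inj a) = unitization_inj (cs_star a).
Proof. by congr (_, _); rewrite /= oppr0. Qed.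

Lemma cs_upper_rnorm a : cs_upper a (rnorm a).
Proof. by rewrite -unitization_norm_inj; apply: upper_nu. Qed.

Lemma cs_upperD a b s t : cs_upper a s -> cs_upper b t ->
  cs_upper (a + b) (s + t).
Proof. by rewrite /cs_upper injD; apply: (upperD sn). Qed.

Lemma cs_upperZ r a s : 0 <= r -> cs_upper a s -> cs_upper (r%:C *: a) (r * s).
Proof. by rewrite /cs_upper injZ; apply: (upperZ sn). Qed.

Lemma cs_upper_positive a : cs_positive a -> cs_upper (- a) 0.
Proof.
case=> b ->; rewrite /cs_upper injN injM -inj_star.
exact: (upper_star_mul sn).
Qed.

Lemma cs_upper_imaginary h : cs_star h = h -> cs_upper ('i *: h) 0.
Proof.
move=> sh; rewrite /cs_upper injZ.
apply: (upper_imaginary sn).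
by rewrite inj_star sh.
Qed.

Lemma cs_positive_star a : cs_positive a -> cs_star a = a.
Proof. by case=> b ->; rewrite cs_starM cs_starK. Qed.

Lemma cs_positive_rnorm a s :
  cs_positive a -> 0 <= s -> cs_upper a s -> rnorm a <= s.
Proof.
move=> a0 s0 as_; rewrite -unitization_norm_inj.
apply: (nu_le_upper sn) => //.
  by rewrite inj_star cs_positive_star.
by rewrite -injN; apply: cs_upper_positive.
Qed.

End CstarOrder.

(** * Extension of cones *)

Section ConeExtension.
Variables (R : realType) (V : lmodType R[i]).
Implicit Types (Q : set (V * R)) (a b : V) (r s t : R).

(** The epigraphs of sublinear functionals are such cones; linear functionals
    below a sublinear one correspond to larger cones. *)
Definition epicone Q :=
  [/\ forall a b s t, Q (a, s) -> Q (b, t) -> Q (a + b, s + t),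
      forall r a s, 0 <= r -> Q (a, s) -> Q (r%:C *: a, r * s)
    & forall s, Q (0, s) -> 0 <= s].

Lemma maximal_epicone Q0 : epicone Q0 ->
  exists Q, [/\ epicone Q, Q0 `<=` Q
    & forall Q', epicone Q' -> Q `<=` Q' -> Q' `<=` Q].
Proof.
move=> cQ0; pose P := [set X : set (V * R) | epicone (X `|` Q0)].
have [F FP Ftot|X [PX maxX]] := @Zorn_bigcup (V * R)%type P.
  set W := \bigcup_(X in F) X `|` Q0.
  have sub X : F X -> X `|` Q0 `<=` W.
    by move=> FX y [Xy|Qy]; [left; exists X|right].
  have dir x y : W x -> W y -> exists Y, [/\ epicone Y, Y `<=` W, Y x & Y y].
    move=> [[X FX Xx]|Qx] [[Y FY Yy]|Qy].
    - have [XY|YX] := Ftot _ _ FX FY.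
        exists (Y `|` Q0); split; [exact: FP|exact: sub|left;
          exact: XY|by left].
      exists (X `|` Q0); split; [exact: FP|exact: sub|by left|left; exact: YX].
    - by exists (X `|` Q0); split; [exact: FP|exact: sub|left|right].
    - by exists (Y `|` Q0); split; [exact: FP|exact: sub|right|left].
    - by exists Q0; split => // z; right.
  split=> [a b s t Wa Wb|r a s r0 Wa|s Ws].
  - have [Y [[YD _ _] YW Ya Yb]] := dir _ _ Wa Wb; apply: YW; exact: YD.
  - have [Y [[_ YZ _] YW Ya _]] := dir _ _ Wa Wa; apply: YW; exact: YZ.
  - by have [Y [[_ _ Y0] _ /Y0]] := dir _ _ Ws Ws.
exists (X `|` Q0); split; [exact: PX|by move=> x; right|move=> Q' cQ' sub].
apply: contrapT => nsub; apply: (maxX Q'); last first.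
  rewrite /P /= (_ : Q' `|` Q0 = Q') //; apply/seteqP; split=> [x []//|x];
    last by left.
  by move=> Qx; apply: sub; right.
by split=> [x Xx|Q'X]; [apply: sub; left|apply: nsub => x /Q'X; left].
Qed.

(** M. Riesz extension: adding to a maximal cone the ray spanned by
    [(- x, - p x)], with [p] the associated sublinear functional, does not
    enlarge it, so that [p (- x) = - p x] and [p] is linear. *)
Lemma epicone_functional Q0 : epicone Q0 -> (forall a, exists s, Q0 (a, s)) ->
  exists phi : V -> R, [/\ forall a b, phi (a + b) = phi a + phi b,
    forall r a, phi (r%:C *: a) = r * phi a
    & forall a s, Q0 (a, s) -> phi a <= s].
Proof.
move=> cQ0 totQ0; have [Q [cQ sQ maxQ]] := maximal_epicone cQ0.
have [QD QZ Q0ge] := cQ.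
have tot a : exists s, Q (a, s) by have [s /sQ] := totQ0 a; exists s.
pose p a := inf [set s | Q (a, s)].
have lb a s t : Q (- a, t) -> Q (a, s) -> - t <= s.
  move=> Qt Qs; rewrite -subr_ge0 opprK; apply: Q0ge.
  by rewrite -(subrr a); apply: QD.
have haslb a : has_lbound [set s | Q (a, s)].
  have [t Qt] := tot (- a); exists (- t) => s; exact: lb.
have p_le a s : Q (a, s) -> p a <= s by move=> Qs; apply: ge_inf.
have p_ge a s : (forall t, Q (a, t) -> s <= t) -> s <= p a.
  by move=> h; apply: lb_le_inf; [exact: tot|move=> t /h].
have Q00 : Q (0, 0).
  have [s Qs] := tot 0; have := QZ 0 _ _ (lexx 0) Qs.
  by rewrite scaler0 mul0r.
have pN x : p (- x) <= - p x.
  apply: (p_le _ _ _); pose Q' := [set y | exists r a s, [/\ 0 <= r, Q (a, s)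
    & y = (a - r%:C *: x, s - r * p x)]].
  have QQ' : Q `<=` Q'.
    by move=> [a s] Qas; exists 0, a, s; rewrite realc0 scale0r mul0r !subr0.
  apply: (maxQ Q' _ QQ'); last first.
    by exists 1, 0, 0; rewrite realc1 scale1r mul1r !sub0r.
  split.
  - move=> _ _ _ _ [r [a [s [r0 Qa [-> ->]]]]] [r' [b [t [r'0 Qb [-> ->]]]]].
    exists (r + r'), (a + b), (s + t); split; [exact: addr_ge0|exact: QD|].
    by congr (_, _); [rewrite realcD; module_eq V|ring].
  - move=> k _ _ k0 [r [a [s [r0 Qa [-> ->]]]]].
    exists (k * r), (k%:C *: a), (k * s); split; [exact: mulr_ge0|exact: QZ|].
    by congr (_, _); [rewrite realcM; module_eq V|ring].
  - move=> _ [r [a [s [r0 Qa [/esym/eqP ax ->]]]]]; rewrite subr_ge0.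
    move: ax; rewrite subr_eq0 => /eqP ax; rewrite ax in Qa.
    move: r0; rewrite le_eqVlt => /orP[/eqP r0|r0].
      by move: Qa; rewrite -r0 realc0 scale0r mul0r => /Q0ge.
    rewrite mulrC -ler_pdivlMr //; apply: p_le.
    have := QZ r^-1 _ _ (ltW (_ : 0 < r^-1)) Qa; rewrite invr_gt0 => /(_ r0).
    by rewrite scalerA -realcM mulVf ?gt_eqF // realc1 scale1r mulrC.
have pD a b : p (a + b) <= p a + p b.
  rewrite -lerBlDr; apply: (p_ge) => s Qs; rewrite lerBlDr -lerBlDl.
  by apply: p_ge => t Qt; rewrite lerBlDl; apply: p_le; apply: QD.
have pA a b : p (a + b) = p a + p b.
  apply/eqP; rewrite eq_le pD /=.
  have := pD (a + b) (- b); rewrite addrK; have := pN b; lra.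
have p0 : p 0 = 0 by have := pA 0 0; rewrite addr0; lra.
have pNE x : p (- x) = - p x.
  by have := pA x (- x); rewrite subrr p0; lra.
have pZ r a : 0 <= r -> p (r%:C *: a) <= r * p a.
  rewrite le_eqVlt => /orP[/eqP<-|r0]; first by rewrite realc0 scale0r p0 mul0r.
  rewrite -ler_pdivrMl //; apply: p_ge => s Qs; rewrite ler_pdivrMl //.
  by apply: p_le; apply: QZ => //; apply: ltW.
have pZE r a : 0 <= r -> p (r%:C *: a) = r * p a.
  move=> r0; apply/eqP; rewrite eq_le pZ //=.
  by have := pZ r (- a) r0; rewrite scalerN !pNE; lra.
exists p; split=> // [r a|a s Qs]; last by apply: p_le; apply: sQ.
have [r0|r0] := leP 0 r; first exact: pZE.
have := pZE (- r) a; rewrite oppr_ge0 (ltW r0) => /(_ isT).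
rewrite realcN scaleNr pNE; lra.
Qed.

End ConeExtension.

(** * Separation by states *)

Section HilbertModuleInner.
Variables (R : realType) (A : cstarAlgebra R) (E : hilbertModule A).
Implicit Types x y z : E.

Lemma hm_innerDl x y z : hm_inner (x + y) z = hm_inner x z + hm_inner y z.
Proof. by rewrite -hm_inner_star hm_innerD cs_starD !hm_inner_star. Qed.

Lemma hm_innerZl k x y : hm_inner (k *: x) y = conjc k *: hm_inner x y.
Proof. by rewrite -hm_inner_star hm_innerZ cs_starZ hm_inner_star. Qed.

Lemma hm_innerNl x y : hm_inner (- x) y = - hm_inner x y.
Proof. by rewrite -scaleN1r hm_innerZl conjcN conjc1 scaleN1r. Qed.

Lemma hm_innerNr x y : hm_inner x (- y) = - hm_inner x y.
Proof. by rewrite -scaleN1r hm_innerZ scaleN1r. Qed.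

Lemma hm_rnormE x : rnorm (hm_inner x x) = rnorm x ^+ 2.
Proof. by apply: complexI; rewrite -rnormE -hm_normE rnormE !expr2 realcM. Qed.

Definition hm_innerE :=
  (hm_innerDl, hm_innerD, hm_innerNl, hm_innerNr, hm_innerZl, hm_innerZ).

(** Operator convexity of [x |-> <x, x>], for weights [r] and [s] that may both
    vanish; the defect is [r s / (r + s)] times [<x - y, x - y>]. *)
Lemma hm_inner_convex x y r s : 0 <= r -> 0 <= s ->
  exists2 p : R * R, [/\ 0 <= p.1, 0 <= p.2 & p.1 + p.2 = 1] &
  exists2 t : R, 0 <= t &
    let z := p.1%:C *: x + p.2%:C *: y in
    (r + s)%:C *: hm_inner z z = r%:C *: hm_inner x x + s%:C *: hm_inner y y
      - t%:C *: hm_inner (x - y) (x - y).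
Proof.
move=> r0 s0; have [rs0|rs] := eqVneq (r + s) 0.
  exists (1, 0); rewrite ?ler01 ?lexx ?addr0 //; exists 0 => //=.
  have [-> ->] : r = 0 /\ s = 0 by split; lra.
  by rewrite addr0 realc0 !scale0r; module_eq A.
exists (r / (r + s), s / (r + s)) => /=.
  by rewrite !divr_ge0 ?addr_ge0 // -mulrDl divff.
exists (r * s / (r + s)); first by rewrite divr_ge0 ?mulr_ge0 ?addr_ge0.
have rsC : r%:C + s%:C != 0 :> R[i].
  by rewrite -realcD (inj_eq (@complexI R) _ 0).
rewrite !hm_innerE !conjc_real !realcE.
by module_eq A; field.
Qed.

End HilbertModuleInner.

Section Functionals.
Variables (R : realType) (A : cstarAlgebra R).
Implicit Types (a b : A) (f : {scalar A}).

(** The formula is forced by [Im (f a) = - Re (f (i a))]. *)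
Lemma complexify_functional (phi : A -> R) :
  (forall a b, phi (a + b) = phi a + phi b) ->
  (forall r a, phi (r%:C *: a) = r * phi a) ->
  exists f : {scalar A}, forall a, f a = phi a -i* phi ('i *: a).
Proof.
move=> phiD phiZ; pose f a := phi a -i* phi ('i *: a).
have lf : linear_for *%R f.
  move=> [x y] a b.
  have -> : x +i* y = x%:C + y%:C * 'i by simpc.
  have e1 : (x%:C + y%:C * 'i) *: a + b = x%:C *: a + (y%:C *: ('i *: a) + b).
    by module_eq A.
  have e2 : 'i *: ((x%:C + y%:C * 'i) *: a + b) =
      x%:C *: ('i *: a) + ((- y)%:C *: a + 'i *: b).
    rewrite realcN; module_eq A.
    by transitivity ('i * x%:C + ('i * 'i) * y%:C); [ring|rewrite mulii; ring].
  rewrite /f e2 e1 !(phiD, phiZ); apply/eqP; rewrite eq_complex /=.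
  by apply/andP; split; apply/eqP; ring.
pose m := GRing.isLinear.Build _ _ _ _ f lf.
pose g : {scalar A} := HB.pack f m.
by exists g.
Qed.

(** Multiply [a] by the phase that makes [f a] real. *)
Lemma functional_bound f (phi : A -> R) :
  (forall a, complex.Re (f a) = phi a) -> (forall a, phi a <= rnorm a) ->
  forall a, rnorm (f a) <= rnorm a.
Proof.
move=> fphi phile a; have [/rnorm_eq0 ->|fa0] := eqVneq (rnorm (f a)) 0.
  by rewrite rnorm0 rnorm_ge0.
have fa_gt0 : 0 < rnorm (f a) by rewrite lt_neqAle eq_sym fa0 rnorm_ge0.
pose u := (rnorm (f a))^-1%:C * conjc (f a).
have -> : rnorm a = rnorm (u *: a).
  by rewrite rnormZ rnormM rnorm_real rnorm_conj gtr0_norm ?invr_gt0 // mulVf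
    // mul1r.
have -> : rnorm (f a) = complex.Re (f (u *: a)).
  rewrite linearZ /= -mulrA [conjc _ * _]mulrC -sqr_normc rnormE expr2 -!realcM.
  by rewrite mulrA mulVf // mul1r.
by rewrite fphi.
Qed.

Lemma functional_normalize f a0 :
  (forall a, cs_positive a -> 0 <= f a) -> (forall a, rnorm (f a) <= rnorm a) ->
  f a0 != 0 ->
  exists2 omega : {scalar A}, is_state omega &
    exists2 N : R, 0 < N & forall a, f a = N%:C * omega a.
Proof.
move=> fpos fle fa0.
(* [N] is the norm of [f]. *)
pose S := [set K : R | 0 <= K /\ forall a, rnorm (f a) <= K * rnorm a].
have S1 : S 1 by split=> // a; rewrite mul1r.
have lbS : has_lbound S by exists 0 => K [].
pose N := inf S.
have N0 : 0 <= N by apply: lb_le_inf; [exists 1|move=> K []].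
have fN a : rnorm (f a) <= N * rnorm a.
  have [a_0|a_n0] := eqVneq (rnorm a) 0; first by have := fle a;
    rewrite a_0 mulr0.
  have a_gt0 : 0 < rnorm a by rewrite lt_neqAle eq_sym a_n0 rnorm_ge0.
  rewrite -ler_pdivrMr //; apply: lb_le_inf; first by exists 1.
  by move=> K [_ fK]; rewrite ler_pdivrMr.
have N_gt0 : 0 < N.
  rewrite lt_neqAle N0 andbT; apply: contra fa0 => /eqP N_0;
    apply/eqP/rnorm_eq0.
  by apply/eqP; rewrite eq_le rnorm_ge0 andbT; have := fN a0;
    rewrite -N_0 mul0r.
pose g a := N^-1%:C * f a.
have lg : linear_for *%R g.
  by move=> k a b; rewrite /g linearP /= mulrDr mulrCA.
pose m := GRing.isLinear.Build _ _ _ _ g lg.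
pose om : {scalar A} := HB.pack g m.
have NV : 0 < N^-1 by rewrite invr_gt0.
have omE a : rnorm (om a) = N^-1 * rnorm (f a).
  by rewrite /om /= /g rnormM rnorm_real gtr0_norm.
exists om; last first.
  exists N => // a; rewrite /om /= /g mulrA -realcM divff ?gt_eqF //.
  by rewrite realc1 mul1r.
split=> [a a_ge0|a|c cle].
- by rewrite /om /= /g mulr_ge0 ?fpos // ler0c ltW.
- by rewrite !rnormE lecR omE mulrC ler_pdivrMr // mulrC.
- have cle' a : rnorm (f a) <= N * c * rnorm a.
    have := cle a; rewrite !rnormE -realcM lecR omE mulrC ler_pdivrMr // => h.
    by rewrite -mulrA mulrC.
  have Nc : 0 <= N * c.
    have fa0_gt0 : 0 < rnorm (f a0).
      rewrite lt_neqAle rnorm_ge0 andbT eq_sym; apply: contra fa0.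
      by move=> /eqP/rnorm_eq0/eqP.
    have := lt_le_trans fa0_gt0 (cle' a0); rewrite leNgt; apply: contraL => Nc.
    by rewrite -leNgt mulr_le0_ge0 ?rnorm_ge0 // ltW.
  have : N <= N * c by apply: ge_inf.
  by rewrite -{1}[N]mulr1 ler_pM2l.
Qed.

End Functionals.

Section Separation.
Variables (R : realType) (A : cstarAlgebra R) (E : hilbertModule A).

(** The cone [Q] is the epigraph of the sublinear functional sending [a] to the
    infimum, over [m] in [M] and [r >= 0], of the upper bounds of
    [a + r <x0 - m, x0 - m>] minus [r d^2].  Convexity makes it a cone, and the
    distance from [x0] to [M] makes it nonnegative over [0].  A functional below
    it is dominated by the norm (take [r = 0]), nonnegative on positive elements
    and zero on [i h] for selfadjoint [h], and at least [d^2] at each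
    [<x0 - m, x0 - m>] (take [r = 1]). *)
Lemma state_separation (M : set E) (x0 : E) (d : R) :
  Defs.subspace M -> 0 < d -> (forall m, M m -> d <= rnorm (x0 - m)) ->
  exists2 omega : {scalar A}, is_state omega &
  exists2 c : R, 0 < c &
    forall m, M m -> c%:C <= omega (hm_inner (x0 - m) (x0 - m)).
Proof.
move=> [M0 MD MZ] d0 Md; pose sq m := hm_inner (x0 - m) (x0 - m).
have sqge m : M m -> d ^+ 2 <= rnorm (sq m).
  by move=> Mm; rewrite hm_rnormE ler_pXn2r ?nnegrE ?rnorm_ge0 ?Md // ltW.
pose Q := [set p : A * R | exists m r s, [/\ M m, 0 <= r, 0 <= s,
  cs_upper (p.1 + r%:C *: sq m) s & s <= p.2 + r * d ^+ 2]].
have up0 : cs_upper (0 : A) 0 by have := cs_upper_rnorm (0 : A); rewrite rnorm0.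
have cQ : epicone Q.
  split.
  - move=> a b s t [m [r [s' [Mm r0 s'0 /= us ss]]]].
    move=> [m' [r' [t' [Mm' r'0 t'0 /= ut tt]]]].
    have [[p q] /= [p0 q0 pq]] := hm_inner_convex (x0 - m) (x0 - m') r0 r'0.
    move=> [k k0]; set z := (p%:C *: _ + _) => zE.
    have zE' : z = x0 - (p%:C *: m + q%:C *: m').
      have q1 : q%:C = 1 - p%:C
        by rewrite -realc1 -realcN -realcD -pq addrC addKr.
      by rewrite /z q1; module_eq E.
    exists (p%:C *: m + q%:C *: m'), (r + r'), (s' + t'); split => /=.
    + by apply: MD; apply: MZ.
    + exact: addr_ge0.
    + exact: addr_ge0.
    + have -> : a + b + (r + r')%:C *: sq (p%:C *: m + q%:C *: m') =
          (a + r%:C *: sq m) + (b + r'%:C *: sq m') +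
          k%:C *: - hm_inner (x0 - m - (x0 - m')) (x0 - m - (x0 - m')).
        by rewrite /sq -zE' zE; module_eq A.
      rewrite -[s' + t']addr0; apply: cs_upperD; first exact: cs_upperD.
      rewrite -(mulr0 k); apply: cs_upperZ => //; apply: cs_upper_positive.
      exact: hm_inner_ge0.
    + by lra.
  - move=> k a s k0 [m [r [s' [Mm r0 s'0 /= us ss]]]].
    exists m, (k * r), (k * s'); split => //=; try exact: mulr_ge0.
      by rewrite realcM -scalerA -scalerDr; apply: cs_upperZ.
    by rewrite -mulrA -mulrDr ler_wpM2l.
  - move=> s [m [r [s' [Mm r0 s'0 /= us ss]]]].
    move: us; rewrite add0r => us.
    have posr : cs_positive (r%:C *: sq m).
      have [b bE] := hm_inner_ge0 (x0 - m).
      exists ((Num.sqrt r)%:C *: b); rewrite cs_starZ cs_mulZl cs_mulZr scalerA.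
      by rewrite conjcE conjc_real -realcM -expr2 sqr_sqrtr // -bE.
    have := cs_positive_rnorm posr s'0 us.
    rewrite rnormZ rnorm_real ger0_norm // => le.
    by have := ler_wpM2l r0 (sqge m Mm); lra.
have Qup a s : 0 <= s -> cs_upper a s -> Q (a, s).
  move=> s0 us; exists 0, 0, s; split => //=; last by rewrite mul0r addr0.
  by rewrite realc0 scale0r addr0.
have totQ a : exists s, Q (a, s).
  by exists (rnorm a); apply: Qup; [exact: rnorm_ge0|exact: cs_upper_rnorm].
have [phi [phiD phiZ phile]] := epicone_functional cQ totQ.
have [f fE] := complexify_functional phiD phiZ.
have phiN a : phi (- a) = - phi a.
  by have := phiZ (- 1) a; rewrite realcN realc1 scaleN1r mulN1r.
have fpos a : cs_positive a -> f a = (phi a)%:C /\ 0 <= phi a.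
  move=> a0; have sa := cs_positive_star a0.
  have im0 : phi ('i *: a) = 0.
    apply/eqP; rewrite eq_le; apply/andP; split.
      by apply: phile; apply: Qup => //; apply: cs_upper_imaginary.
    rewrite -oppr_le0 -phiN -scalerN; apply: phile; apply: Qup => //.
    by apply: cs_upper_imaginary; rewrite cs_starN sa.
  split; first by rewrite fE im0 oppr0.
  rewrite -oppr_le0 -phiN; apply: phile; apply: Qup => //.
  exact: cs_upper_positive.
have fle : forall a, rnorm (f a) <= rnorm a.
  apply: (functional_bound (phi := phi)) => a; first by rewrite fE.
  by apply: phile; apply: Qup; [exact: rnorm_ge0|exact: cs_upper_rnorm].
have phisq m : M m -> d ^+ 2 <= phi (sq m).
  move=> Mm; rewrite -lerN2 -phiN; apply: phile.
  exists m, 1, 0; split => //=; last by rewrite mul1r addNr.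
  by rewrite realc1 scale1r addNr.
have d20 : 0 < d ^+ 2 by rewrite exprn_gt0.
have sqE m : f (sq m) = (phi (sq m))%:C.
  by have [] := fpos _ (hm_inner_ge0 (x0 - m)).
have [a a0||omega st [N N0 fN]] := @functional_normalize _ _ f (sq 0) _ fle.
- by have [-> ?] := fpos _ a0; rewrite ler0c.
- rewrite sqE (inj_eq (@complexI R) _ 0) gt_eqF //.
  exact: lt_le_trans d20 (phisq _ M0).
exists omega => //; exists (N^-1 * d ^+ 2); first by rewrite mulr_gt0 ?invr_gt0.
move=> m Mm;
  have -> : omega (hm_inner (x0 - m) (x0 - m)) = (N^-1 * phi (sq m))%:C.
  apply: (mulfI (_ : N%:C != 0));
    first by rewrite (inj_eq (@complexI R) _ 0) gt_eqF.
  by rewrite -fN sqE -realcM mulrA divff ?gt_eqF // mul1r.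
by rewrite lecR ler_pM2l ?invr_gt0 // phisq.
Qed.

End Separation.

(** * Completion of a pre-Hilbert space *)

(** Limits of Cauchy families are obtained from the completeness of the order:
    a family of intervals any two of which meet has a common point.  The index
    may be a ball of a Cauchy filter as well as an approximation with its
    error. *)
Section IntervalLimit.
Variables (R : realType) (I : Type) (D : set I) (i0 : I).
Hypothesis Di0 : D i0.

Lemma interval_limit (u rad : I -> R) :
  (forall i j, D i -> D j -> `|u i - u j| <= rad i + rad j) ->
  exists l, forall i, D i -> `|u i - l| <= rad i.
Proof.
move=> near; pose S := [set u i - rad i | i in D].
have lub i j : D i -> D j -> u i - rad i <= u j + rad j.
  move=> Di Dj; have := near _ _ Di Dj; have := ler_norm (u i - u j); lra.
have ubS j : D j -> ubound S (u j + rad j).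
  by move=> Dj _ [i Di <-]; apply: lub.
have supS : has_sup S.
  by split; [exists (u i0 - rad i0); exists i0|exists (u i0 + rad i0);
    apply: ubS].
exists (sup S) => i Di; rewrite ler_norml.
have : u i - rad i <= sup S by apply: sup_upper_bound => //; exists i.
have : sup S <= u i + rad i by apply: ge_sup; [case: supS|exact: ubS].
by lra.
Qed.

Lemma complex_interval_limit (u : I -> R[i]) (rad : I -> R) :
  (forall i j, D i -> D j -> rnorm (u i - u j) <= rad i + rad j) ->
  exists l, forall i, D i -> rnorm (u i - l) <= 2 * rad i.
Proof.
move=> near.
have ReB (z w : R[i]) : complex.Re (z - w) = complex.Re z - complex.Re w.
  by case: z w => [? ?] [? ?].
have ImB (z w : R[i]) : complex.Im (z - w) = complex.Im z - complex.Im w.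
  by case: z w => [? ?] [? ?].
have [i j Di Dj|a ha] := @interval_limit (fun i => complex.Re (u i)) rad.
  by rewrite -ReB; apply: le_trans (Re_norm_le _) (near _ _ Di Dj).
have [i j Di Dj|b hb] := @interval_limit (fun i => complex.Im (u i)) rad.
  by rewrite -ImB; apply: le_trans (Im_norm_le _) (near _ _ Di Dj).
exists (a +i* b) => i Di; apply: le_trans (rnorm_le_ReIm _) _.
by rewrite ReB ImB /=; have := ha _ Di; have := hb _ Di; lra.
Qed.

End IntervalLimit.

Record preHilbert (R : realType) := PreHilbert {
  ph_sort :> lmodType R[i];
  ph_inner : ph_sort -> ph_sort -> R[i];
  ph_innerD : forall x y z : ph_sort,
    ph_inner x (y + z) = ph_inner x y + ph_inner x z;
  ph_innerZ : forall (k : R[i]) (x y : ph_sort),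
    ph_inner x (k *: y) = k * ph_inner x y;
  ph_inner_conj : forall x y : ph_sort,
    conjc (ph_inner x y) = ph_inner y x;
  ph_inner_ge0 : forall x : ph_sort, 0 <= ph_inner x x
}.

Section PreHilbertTheory.
Variables (R : realType) (V : preHilbert R).
Implicit Types (x y z : V) (k : R[i]) (f g : V -> R[i]) (e r : R).
Local Notation s := (@ph_inner R V).

Lemma ph_innerDl x y z : s (x + y) z = s x z + s y z.
Proof. by rewrite -ph_inner_conj ph_innerD conjcD !ph_inner_conj. Qed.

Lemma ph_innerZl k x y : s (k *: x) y = conjc k * s x y.
Proof. by rewrite -ph_inner_conj ph_innerZ conjcM ph_inner_conj. Qed.

Lemma ph_innerNr x y : s x (- y) = - s x y.
Proof. by rewrite -scaleN1r ph_innerZ mulN1r. Qed.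

Lemma ph_innerNl x y : s (- x) y = - s x y.
Proof. by rewrite -ph_inner_conj ph_innerNr conjcN ph_inner_conj. Qed.

Definition ph_innerE :=
  (ph_innerDl, ph_innerD, ph_innerNl, ph_innerNr, ph_innerZl, ph_innerZ).

Definition ph_norm x := Num.sqrt (complex.Re (s x x)).
Local Notation n := ph_norm.

Lemma ph_norm_ge0 x : 0 <= n x.
Proof. exact: sqrtr_ge0. Qed.

Lemma ph_normE x : s x x = (n x ^+ 2)%:C.
Proof.
have /[dup] s0 := ph_inner_ge0 x; rewrite lecE /= => /andP[_ re0].
by rewrite sqr_sqrtr // RRe_real // ger0_real.
Qed.

(** Cauchy-Schwarz, from the nonnegativity of [s] at [x - t z y] for every real
    [t], where [z = s y x]. *)
Lemma ph_cauchy_schwarz x y : rnorm (s x y) <= n x * n y.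
Proof.
set m := rnorm (s x y); have m0 : 0 <= m := rnorm_ge0 _.
have quad t : 0 <= n x ^+ 2 - 2 * t * m ^+ 2 + t ^+ 2 * m ^+ 2 * n y ^+ 2.
  pose k := t%:C * s y x.
  have kk : s y x * s x y = (m ^+ 2)%:C.
    by rewrite -ph_inner_conj mulrC -sqr_normc rnormE !expr2 realcM.
  rewrite -ler0c;
    have -> : (n x ^+ 2 - 2 * t * m ^+ 2 + t ^+ 2 * m ^+ 2 * n y ^+ 2)%:C
     = s (x - k *: y) (x - k *: y) :> R[i]; last exact: ph_inner_ge0.
  rewrite !ph_innerE !(ph_normE) /k conjcM conjc_real ph_inner_conj.
  rewrite !expr2 !realcE -!expr2 in kk *.
  by ring: kk.
clearbody m.
rewrite -(ler_pXn2r (n := 2)) ?nnegrE ?mulr_ge0 ?ph_norm_ge0 // exprMn.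
have [ny0|ny0] := eqVneq (n y ^+ 2) 0.
  rewrite ny0 mulr0 leNgt; apply/negP => m20.
  have := quad ((n x ^+ 2 + 1) / (2 * m ^+ 2)); rewrite ny0 mulr0 addr0.
  have -> : 2 * ((n x ^+ 2 + 1) / (2 * m ^+ 2)) * m ^+ 2 = n x ^+ 2 + 1.
    by field; apply: contraTneq m20 => ->; rewrite expr0n ltxx.
  by lra.
have ny1 : 0 < n y ^+ 2 by rewrite lt_neqAle eq_sym ny0 sqr_ge0.
have := quad (n y ^+ 2)^-1;
  move: (n x ^+ 2) (m ^+ 2) (n y ^+ 2) ny1 => a b c c0.
have -> : a - 2 * c^-1 * b + c^-1 ^+ 2 * b * c = (a * c - b) / c.
  by field; rewrite gt_eqF.
by rewrite pmulr_lge0 ?invr_gt0 // subr_ge0.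
Qed.

Lemma ph_norm_le x r : 0 <= r -> n x ^+ 2 <= r * n x -> n x <= r.
Proof.
move=> r0; have [->//|nx0] := eqVneq (n x) 0.
by rewrite expr2 ler_pM2r // lt_neqAle eq_sym nx0 ph_norm_ge0.
Qed.

Definition ph_approx f e x := forall y, rnorm (f y - s y x) <= e * n y.

(** The completion of [V] consists of the functions that are uniform limits, on
    the unit ball, of the functions [s ^~ x]: it is realized inside the
    antidual of [V], where limits can be taken pointwise. *)
Definition ph_antidual : {pred V -> R[i]} :=
  fun f => `[< forall e, 0 < e -> exists x, ph_approx f e x >].

Lemma ph_antidualP f :
  reflect (forall e, 0 < e -> exists x, ph_approx f e x) (f \in ph_antidual).
Proof. exact: asboolP. Qed.

Lemma ph_approxD f g e r x y : ph_approx f e x -> ph_approx g r y ->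
  ph_approx (f + g) (e + r) (x + y).
Proof.
move=> fx gy z; rewrite ph_innerD mulrDl.
have -> : (f + g) z - (s z x + s z y) = (f z - s z x) + (g z - s z y).
  by rewrite -[(f + g) z]/(f z + g z); ring.
by apply: le_trans (rnormD _ _) _; apply: lerD.
Qed.

Lemma ph_approxZ f e x k : ph_approx f e x ->
  ph_approx (k *: f) (rnorm k * e) (k *: x).
Proof.
move=> fx z; rewrite ph_innerZ -[(k *: f) z]/(k * f z) -mulrBr rnormM -mulrA.
by rewrite ler_wpM2l ?rnorm_ge0.
Qed.

Lemma ph_antidual_submod_closed : submod_closed ph_antidual.
Proof.
split=> [|k f g /ph_antidualP fa /ph_antidualP ga]; apply/ph_antidualP => e e0.
  exists 0 => y; have -> : s y 0 = 0 by rewrite -(scale0r 0) ph_innerZ mul0r.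
  by rewrite -[(0 : V -> R[i]) y]/0 subr0 rnorm0 mulr_ge0 ?ph_norm_ge0 ?ltW.
have k0 : 0 < rnorm k + 1 by have := rnorm_ge0 k; lra.
have e2 : 0 < e / 2 by lra.
have [x fx] := fa _ (divr_gt0 e2 k0); have [y gy] := ga _ e2.
exists (k *: x + y) => z; apply: le_trans (ph_approxD (ph_approxZ k fx) gy z) _.
rewrite ler_wpM2r ?ph_norm_ge0 //.
have : rnorm k * (e / 2 / (rnorm k + 1)) <= e / 2.
  rewrite mulrA ler_pdivrMr // mulrC ler_pM2l ?divr_gt0 //; lra.
by lra.
Qed.

HB.instance Definition _ := GRing.isSubmodClosed.Build _ _ ph_antidual
  ph_antidual_submod_closed.

Record ph_completion := PhCompletion {
  ph_val :> V -> R[i];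
  _ : ph_val \in ph_antidual
}.

HB.instance Definition _ := [isSub for ph_val].
HB.instance Definition _ := [Choice of ph_completion by <:].
HB.instance Definition _ := [SubChoice_isSubLmodule of ph_completion by <:].

Implicit Types F G : ph_completion.

Lemma ph_completionP F e : 0 < e -> exists x, ph_approx F e x.
Proof. by case: F => f fP; apply/ph_antidualP. Qed.

Definition ph_opnorm F : R :=
  inf [set K | 0 <= K /\ forall y, rnorm (F y) <= K * n y].
Local Notation N := ph_opnorm.

Let bounds F : [set K | 0 <= K /\ forall y, rnorm (F y) <= K * n y] !=set0.
Proof.
have [x Fx] := ph_completionP F ltr01; exists (1 + n x); split=> [|y].
  by rewrite addr_ge0 ?ph_norm_ge0.
have -> : F y = (F y - s y x) + s y x by rewrite subrK.
apply: le_trans (rnormD _ _) _; rewrite mulrDl; apply: lerD; first exact: Fx.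
by rewrite mulrC ph_cauchy_schwarz.
Qed.

Lemma ph_opnorm_ge0 F : 0 <= N F.
Proof. by apply: lb_le_inf => // K []. Qed.

Lemma ph_opnorm_le F y : rnorm (F y) <= N F * n y.
Proof.
have [y0|y0] := eqVneq (n y) 0.
  by have [K [_ /(_ y)]] := bounds F; rewrite y0 !mulr0.
have y_gt0 : 0 < n y by rewrite lt_neqAle eq_sym y0 ph_norm_ge0.
rewrite -ler_pdivrMr //; apply: lb_le_inf => // K [_ FK].
by rewrite ler_pdivrMr.
Qed.

Lemma ph_opnorm_min F K : 0 <= K -> (forall y, rnorm (F y) <= K * n y) ->
  N F <= K.
Proof. by move=> K0 FK; apply: ge_inf => //; exists 0 => L []. Qed.

Lemma ph_opnormD F G : N (F + G) <= N F + N G.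
Proof.
apply: ph_opnorm_min => [|y]; first by rewrite addr_ge0 ?ph_opnorm_ge0.
rewrite mulrDl -[(F + G : ph_completion) y]/(F y + G y).
by apply: le_trans (rnormD _ _) _; apply: lerD; apply: ph_opnorm_le.
Qed.

Lemma ph_opnormZ k F : N (k *: F) = rnorm k * N F.
Proof.
have le l G : N (l *: G) <= rnorm l * N G.
  apply: ph_opnorm_min => [|y];
    first by rewrite mulr_ge0 ?ph_opnorm_ge0 ?rnorm_ge0.
  rewrite -[(l *: G : ph_completion) y]/(l * G y) rnormM -mulrA.
  by rewrite ler_wpM2l ?rnorm_ge0 ?ph_opnorm_le.
apply/eqP; rewrite eq_le le /=.
have [->|k0] := eqVneq k 0; first by rewrite rnorm0 mul0r ph_opnorm_ge0.
have rk := rnorm_gt0 k0.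
rewrite mulrC -ler_pdivlMr // mulrC.
rewrite -rnormV.
by rewrite -{1}(scale1r F) -(mulVf k0) -scalerA.
Qed.

Lemma ph_opnorm_eq0 F : N F = 0 -> F = 0.
Proof.
move=> NF; apply/val_inj/funext => y /=.
by apply: rnorm_eq0; apply/eqP;
  rewrite eq_le rnorm_ge0 andbT -(mul0r (n y)) -NF ph_opnorm_le.
Qed.

Definition ph_cnorm F : R[i] := (N F)%:C.

Lemma ph_cnormD F G : ph_cnorm (F + G) <= ph_cnorm F + ph_cnorm G.
Proof. by rewrite -realcD lecR ph_opnormD. Qed.

Lemma ph_cnormZ k F : ph_cnorm (k *: F) = `|k| * ph_cnorm F.
Proof. by rewrite rnormE -realcM -ph_opnormZ. Qed.

Lemma ph_cnorm_eq0 F : ph_cnorm F = 0 -> F = 0.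
Proof. by move=> [/ph_opnorm_eq0]. Qed.

HB.instance Definition _ :=
  Lmodule_isNormed.Build R[i] ph_completion ph_cnormD ph_cnormZ ph_cnorm_eq0.

Lemma ph_rnormE F : rnorm F = N F.
Proof. by []. Qed.

Lemma ph_opnormN F : N (- F) = N F.
Proof. by rewrite -scaleN1r ph_opnormZ rnormN rnorm1 mul1r. Qed.

(** The balls that belong to the filter have centers that form a Cauchy family
    at each point of [V]; their pointwise limit is the limit of the filter. *)
Lemma ph_completion_cauchy_cvg (X : set_system ph_completion) :
  ProperFilter X -> cauchy X -> cvg X.
Proof.
move=> XF /cauchyP Xc.
pose D := [set p : ph_completion * R | 0 < p.2 /\ X (ball p.1 p.2%:C)].
have small r : 0 < r -> exists F, D (F, r).
  move=> r0; have [|F XFr] := Xc r%:C; first by rewrite ltcR.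
  by exists F.
have ballN F G r : ball F r%:C G -> N (F - G) < r.
  by rewrite -ball_normE /= rnormE ltcR.
have DD p q : D p -> D q -> N (p.1 - q.1) <= p.2 + q.2.
  move=> [p0 Xp] [q0 Xq];
    have [F [/ballN pF /ballN qF]] := filter_ex (filterI Xp Xq).
  have -> : p.1 - q.1 = (p.1 - F) - (q.1 - F) by module_eq ph_completion.
  by apply: le_trans (ph_opnormD _ _) _; rewrite ph_opnormN; lra.
have [F1 DF1] := small 1 ltr01.
have lim y : exists l, forall p, D p -> rnorm (p.1 y - l) <= 2 * (p.2 * n y).
  apply: (complex_interval_limit DF1) => p q Dp Dq; rewrite -mulrDl.
  have := ph_opnorm_le (p.1 - q.1) y;
    rewrite -[(p.1 - q.1 : ph_completion) y]/(p.1 y - q.1 y).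
  by move=> /le_trans; apply; rewrite ler_wpM2r ?ph_norm_ge0 ?DD.
have [g gP] := choice lim.
have gA : g \in ph_antidual.
  apply/ph_antidualP => e e0; have e4 : 0 < e / 4 by lra.
  have e2 : 0 < e / 2 by lra.
  have [F DF] := small _ e4; have [x Fx] := ph_completionP F e2.
  exists x => y; have := gP y _ DF; have := Fx y => /= h1 h2.
  have -> : g y - s y x = (F y - s y x) - (F y - g y) by ring.
  by apply: le_trans (rnormD _ _) _; rewrite rnormN; lra.
pose G := PhCompletion gA.
have NG p : D p -> N (p.1 - G) <= 2 * p.2.
  move=> Dp; apply: ph_opnorm_min => [|y]; first by case: Dp; lra.
  by rewrite -mulrA; apply: gP.
apply: (cvgP G); apply/cvg_ballP => e e0.
have [r re] : exists r, e = r%:C.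
  by exists (complex.Re e); rewrite RRe_real // gtr0_real.
move: e0; rewrite re ltcR => r0.
have r4 : 0 < r / 4 by lra.
have [F DF] := small _ r4.
have [_ /= XFr] := DF; apply: filterS XFr => H /ballN FH.
rewrite -ball_normE /= rnormE ltcR ph_rnormE.
have -> : G - H = (F - H) - (F - G) by module_eq ph_completion.
apply: le_lt_trans (ph_opnormD _ _) _; rewrite ph_opnormN.
by have := NG _ DF => /=; lra.
Qed.

HB.instance Definition _ :=
  Uniform_isComplete.Build ph_completion ph_completion_cauchy_cvg.

(** [F] pairs with [G] to the limit of [G x] as [s ^~ x] tends to [F]. *)
Definition ph_cinner F G : R[i] :=
  xget 0 [set l | forall x e, 0 <= e -> ph_approx F e x ->
    rnorm (G x - l) <= 2 * (e * N G)].

Lemma ph_approx_norm F e x : 0 <= e -> ph_approx F e x ->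
  `|n x - N F| <= e.
Proof.
move=> e0 Fx; rewrite ler_norml; apply/andP; split.
  suff : N F <= n x + e by lra.
  apply: ph_opnorm_min => [|y]; first by rewrite addr_ge0 ?ph_norm_ge0.
  have -> : F y = s y x + (F y - s y x) by ring.
  apply: le_trans (rnormD _ _) _; rewrite mulrDl; apply: lerD; last exact: Fx.
  by rewrite mulrC ph_cauchy_schwarz.
suff : n x <= N F + e by lra.
apply: ph_norm_le; first by rewrite addr_ge0 ?ph_opnorm_ge0.
have -> : n x ^+ 2 = rnorm (s x x)
  by rewrite ph_normE rnorm_real ger0_norm ?sqr_ge0.
have -> : s x x = F x - (F x - s x x) by ring.
apply: le_trans (rnormD _ _) _; rewrite mulrDl rnormN; apply: lerD;
  last exact: Fx.
exact: ph_opnorm_le.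
Qed.


Lemma le_of_small (a b C : R) : (forall e, 0 < e <= 1 -> a <= b + C * e) ->
  a <= b.
Proof.
move=> le; have [C0|C0] := leP C 0; first by have := le 1 _;
  rewrite ltr01 lexx => /(_ isT); lra.
apply/ler_addgt0Pr => e e0; have : 0 < Num.min 1 (e / C) <= 1.
  by rewrite lt_min ltr01 divr_gt0 //= ge_min lexx.
move=> /le /le_trans; apply; rewrite lerD2l mulrC -ler_pdivlMr //.
by rewrite ge_min lexx orbT.
Qed.

Lemma eq_of_small (l l' : R[i]) (C : R) :
  (forall e, 0 < e <= 1 -> rnorm (l - l') <= C * e) -> l = l'.
Proof.
move=> small; apply/eqP; rewrite -subr_eq0; apply/eqP/rnorm_eq0/eqP.
rewrite eq_le rnorm_ge0 andbT; apply: (@le_of_small _ _ C) => e e0.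
by rewrite add0r small.
Qed.

Lemma ph_completionB F x y : F (x - y) = F x - F y.
Proof.
apply: (@eq_of_small _ _ (n (x - y) + n x + n y)) => e /andP[e0 _].
have [z Fz] := ph_completionP F e0.
have -> : F (x - y) - (F x - F y) =
    (F (x - y) - s (x - y) z) - (F x - s x z) + (F y - s y z).
  by rewrite ph_innerDl ph_innerNl; ring.
have := Fz (x - y); have := Fz x; have := Fz y.
have := rnormD (F (x - y) - s (x - y) z) (- (F x - s x z)); rewrite rnormN.
have := rnormD ((F (x - y) - s (x - y) z) - (F x - s x z)) (F y - s y z).
by rewrite !mulrDl ![_ * e]mulrC; lra.
Qed.

Lemma ph_cinnerP F G x e : 0 <= e -> ph_approx F e x ->
  rnorm (G x - ph_cinner F G) <= 2 * (e * N G).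
Proof.
rewrite /ph_cinner; case: xgetP => [l _ lP|nl]; first exact: lP.
exfalso; pose D := [set p : V * R | 0 <= p.2 /\ ph_approx F p.2 p.1].
have [x0 Fx0] := ph_completionP F ltr01.
have Dx0 : D (x0, 1) by split => /=.
have [|l lP] := complex_interval_limit Dx0 (u := fun p => G p.1)
  (rad := fun p => p.2 * N G).
  move=> [z r] [w t] [/= r0 Fz] [/= t0 Fw].
  have zw : n (z - w) <= r + t.
    apply: ph_norm_le; first exact: addr_ge0.
    have -> : n (z - w) ^+ 2 = rnorm (s (z - w) (z - w)).
      by rewrite ph_normE rnorm_real ger0_norm ?sqr_ge0.
    have -> : s (z - w) (z - w) =
        (F (z - w) - s (z - w) w) - (F (z - w) - s (z - w) z).
      by rewrite ph_innerD ph_innerNr; ring.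
    apply: le_trans (rnormD _ _) _; rewrite rnormN mulrDl addrC.
    by apply: lerD; [exact: Fz|exact: Fw].
  rewrite -mulrDl -ph_completionB; apply: le_trans (ph_opnorm_le _ _) _.
  by rewrite mulrC ler_wpM2r ?ph_opnorm_ge0.
by apply: (nl l) => y r r0 Fy; apply: (lP (y, r)).
Qed.

(** Identities between inner products are checked on approximations, to first
    order in their error. *)
Lemma ph_cinner_unique F G l C :
  (forall x e, 0 < e <= 1 -> ph_approx F e x -> rnorm (G x - l) <= C * e) ->
  ph_cinner F G = l.
Proof.
move=> lP; apply: (@eq_of_small _ _ (2 * N G + C)) => e e01.
have [e0 e1] := andP e01; have [x Fx] := ph_completionP F e0.
have := lP _ _ e01 Fx; have := ph_cinnerP G (ltW e0) Fx.
have -> : ph_cinner F G - l = (G x - l) - (G x - ph_cinner F G) by ring.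
by have := rnormD (G x - l) (- (G x - ph_cinner F G)); rewrite rnormN; lra.
Qed.

Lemma ph_cinnerD F G H : ph_cinner F (G + H) = ph_cinner F G + ph_cinner F H.
Proof.
apply: (@ph_cinner_unique _ _ _ (2 * (N G + N H))) => x e /andP[e0 _] Fx.
rewrite -[(G + H : ph_completion) x]/(G x + H x).
have := ph_cinnerP G (ltW e0) Fx; have := ph_cinnerP H (ltW e0) Fx.
have := rnormD (G x - ph_cinner F G) (H x - ph_cinner F H).
have -> : G x - ph_cinner F G + (H x - ph_cinner F H) =
  G x + H x - (ph_cinner F G + ph_cinner F H) by ring.
by lra.
Qed.

Lemma ph_cinnerZ k F G : ph_cinner F (k *: G) = k * ph_cinner F G.
Proof.
apply: (@ph_cinner_unique _ _ _ (rnorm k * (2 * N G))) => x e /andP[e0 _] Fx.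
rewrite -[(k *: G : ph_completion) x]/(k * G x) -mulrBr rnormM -mulrA.
rewrite ler_wpM2l ?rnorm_ge0 // -mulrA [N G * e]mulrC.
exact: ph_cinnerP (ltW e0) Fx.
Qed.

Lemma ph_cinner_conj F G : Num.conj (ph_cinner F G) = ph_cinner G F.
Proof.
apply/esym; apply: (@ph_cinner_unique _ _ _ (N F)) => x e /andP[e0 e1] Gx.
apply: (@le_of_small _ _ (n x + e + 2 * N G)) => r /andP[r0 r1].
have [z Fz] := ph_completionP F r0; rewrite conjcE.
have := ph_cinnerP G (ltW r0) Fz; have := Fz x; have := Gx z.
have := ph_approx_norm (ltW r0) Fz; rewrite ler_norml => /andP[_ nz].
have -> : F x - conjc (ph_cinner F G) = (F x - s x z) -
    conjc (G z - s z x) + conjc (G z - ph_cinner F G).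
  by rewrite !conjcD !conjcN ph_inner_conj; ring.
have := rnormD (F x - s x z) (- conjc (G z - s z x)).
have := rnormD (F x - s x z - conjc (G z - s z x)) (conjc (G z - ph_cinner F
  G)).
rewrite rnormN !rnorm_conj.
have : e * n z <= e * (N F + r) by apply: (ler_wpM2l (ltW e0)); lra.
by lra.
Qed.

Lemma ph_cinner_norm F : `|F| ^+ 2 = ph_cinner F F.
Proof.
rewrite rnormE expr2 -realcM; apply/esym.
apply: (@ph_cinner_unique _ _ _ (3 * N F + 2)) => x e /andP[e0 e1] Fx.
have := Fx x; have := ph_approx_norm (ltW e0) Fx.
have -> : F x - (rnorm F * rnorm F)%:C =
    (F x - s x x) + ((n x - N F) * (n x + N F))%:C.
  by rewrite ph_normE ph_rnormE !realcE; ring.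
move=> nN FF; apply: le_trans (rnormD _ _) _; rewrite rnorm_real normrM.
have nx := ph_norm_ge0 x; have NF := ph_opnorm_ge0 F.
rewrite (ger0_norm (addr_ge0 nx NF)).
have nle : n x <= N F + 1 by move: nN; rewrite ler_norml => /andP[_]; lra.
have : `|n x - N F| * (n x + N F) <= e * (2 * N F + 1).
  by apply: ler_pM; rewrite ?addr_ge0 //; lra.
have : e * n x <= e * (N F + 1) by apply: (ler_wpM2l (ltW e0)).
by lra.
Qed.

Definition ph_hilbert : hilbertSpace R :=
  HilbertSpace ph_cinnerD ph_cinnerZ ph_cinner_conj ph_cinner_norm.

Lemma ph_iota_subproof x : s ^~ x \in ph_antidual.
Proof.
by apply/ph_antidualP => e e0; exists x => y;
  rewrite subrr rnorm0 mulr_ge0 ?ph_norm_ge0 ?ltW.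
Qed.

Definition ph_iota x : ph_hilbert := PhCompletion (ph_iota_subproof x).

Lemma ph_iota_linear : linear ph_iota.
Proof. by move=> k x y; apply/val_inj/funext => z /=;
  rewrite ph_innerD ph_innerZ. Qed.

HB.instance Definition _ :=
  GRing.isLinear.Build _ _ _ _ ph_iota ph_iota_linear.

Definition ph_embedding : {linear V -> ph_hilbert} := ph_iota.

Lemma ph_iota_inner x y : hs_inner (ph_iota x) (ph_iota y) = s x y.
Proof.
have approx : ph_approx (ph_iota x : ph_completion) 0 x.
  by move=> z; rewrite /= subrr rnorm0 mul0r.
have := ph_cinnerP (ph_iota y) (lexx 0) approx; rewrite mul0r mulr0 => le0.
apply/eqP; rewrite eq_sym -subr_eq0; apply/eqP/rnorm_eq0/eqP.
by rewrite eq_le rnorm_ge0 andbT.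
Qed.

Lemma ph_iota_dense : dense (range ph_iota).
Proof.
move=> O [F OF] Oopen.
have /nbhs_ballP[e /= e0 eO] := open_nbhs_nbhs (conj Oopen OF).
have [r re] : exists r, e = r%:C.
  by exists (complex.Re e); rewrite RRe_real // gtr0_real.
move: e0 eO; rewrite re ltcR => r0 eO; have r2 : 0 < r / 2 by lra.
have [x Fx] := ph_completionP F r2.
exists (ph_iota x); split; last by exists x.
apply: eO; rewrite -ball_normE /= rnormE ltcR ph_rnormE.
apply: (@le_lt_trans _ _ (r / 2)); last by lra.
by apply: ph_opnorm_min; [exact: ltW|exact: Fx].
Qed.

End PreHilbertTheory.

Section LocalizationSpaceExists.
Variables (R : realType) (A : cstarAlgebra R) (E : hilbertModule A).
Variable omega : {scalar A}.
Hypothesis omega_ge0 : forall a : A, cs_positive a -> 0 <= omega a.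

Let s (x y : E) := omega (hm_inner x y).

Let sD x y z : s x (y + z) = s x y + s x z.
Proof. by rewrite /s hm_innerD linearD. Qed.

Let sZ k x y : s x (k *: y) = k * s x y.
Proof. by rewrite /s hm_innerZ linearZ. Qed.

Let sDl x y z : s (x + y) z = s x z + s y z.
Proof. by rewrite /s hm_innerDl linearD. Qed.

Let sZl k x y : s (k *: x) y = conjc k * s x y.
Proof. by rewrite /s hm_innerZl linearZ. Qed.

Let s_ge0 x : 0 <= s x x.
Proof. exact/omega_ge0/hm_inner_ge0. Qed.

(* A sesquilinear form that is real on the diagonal is hermitian. *)
Let s_conj x y : conjc (s x y) = s y x.
Proof.
have im0 z : complex.Im (s z z) = 0 := ger0_Im (s_ge0 z).
have := im0 (x + y); have := im0 (x + 'i *: y).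
rewrite !(sD, sZ, sDl, sZl) conjci; have := im0 x; have := im0 y.
case: (s x x) (s y y) (s x y) (s y x) => [a a'] [b b'] [c c'] [d d'] /=.
move=> -> -> h1 h2; apply/eqP; rewrite eq_complex /=; apply/andP.
by split; apply/eqP; lra.
Qed.

Lemma localizationSpace_exists : exists L : localizationSpace E omega, True.
Proof.
pose V := PreHilbert sD sZ s_conj s_ge0.
by exists (@LocalizationSpace R A E omega (ph_hilbert V) (ph_embedding V)
  (@ph_iota_inner R V) (@ph_iota_dense R V)).
Qed.

End LocalizationSpaceExists.

(** * Limits and density in terms of real norms *)

Section NormedTopology.
Variables (R : realType) (E : normedModType R[i]).
Implicit Types (D : set E) (T : set (E * E)).

Lemma near_rnorm (x : E) (P : set E) :
  nbhs x P <-> exists2 e : R, 0 < e & forall y, rnorm (x - y) < e -> P y.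
Proof.
split=> [/nbhs_ballP[e /= e0 eP]|[e e0 eP]].
  have eE : e = (complex.Re e)%:C by rewrite RRe_real // gtr0_real.
  exists (complex.Re e) => [|y xy]; first by rewrite -ltcR -eE.
  by apply: eP; rewrite -ball_normE /= rnormE eE ltcR.
apply/nbhs_ballP; exists e%:C; first by rewrite /= ltcR.
by move=> y; rewrite -ball_normE /= rnormE ltcR; apply: eP.
Qed.

Lemma dense_rnorm D :
  dense D <-> forall x (e : R), 0 < e -> exists2 y, D y & rnorm (x - y) < e.
Proof.
split=> [denseD x e e0|near O [x Ox] Oo].
  have Nx : nbhs x [set y | rnorm (x - y) < e] by apply/near_rnorm; exists e.
  have [y [/interior_subset yx Dy]] :=
    denseD _ (ex_intro _ x Nx) (open_interior _).
  by exists y.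
have /near_rnorm[e e0 eO] := open_nbhs_nbhs (conj Oo Ox).
by have [y Dy xy] := near x e e0; exists y; split=> //; apply: eO.
Qed.

Lemma closure_rnorm T (p : E * E) :
  closure T p <-> forall e : R, 0 < e ->
    exists2 q, T q & rnorm (p.1 - q.1) < e /\ rnorm (p.2 - q.2) < e.
Proof.
case: p => x y; split=> [cl e e0|near B].
  have Nx : nbhs x [set z | rnorm (x - z) < e] by apply/near_rnorm; exists e.
  have Ny : nbhs y [set z | rnorm (y - z) < e] by apply/near_rnorm; exists e.
  have : nbhs (x, y) ([set z | rnorm (x - z) < e] `*` [set z | rnorm (y - z) <
    e]).
    by exists ([set z | rnorm (x - z) < e], [set z | rnorm (y - z) < e]).
  by move=> /cl[q [Tq [q1 q2]]]; exists q.
move=> [[B1 B2] /= [/near_rnorm[e1 e10 h1] /near_rnorm[e2 e20 h2]] sB].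
have [|q Tq [q1 q2]] := near (Num.min e1 e2); first by rewrite lt_min e10.
exists q; split=> //; apply: sB; split=> /=.
  by apply: h1; apply: lt_le_trans q1 _; rewrite ge_min lexx.
by apply: h2; apply: lt_le_trans q2 _; rewrite ge_min lexx orbT.
Qed.

End NormedTopology.

Lemma complete_limit (R : realType) (E : completeNormedModType R[i])
    (u : nat -> E) (C : R) :
  (forall i j, rnorm (u i - u j) <= C * (i.+1%:R^-1 + j.+1%:R^-1)) ->
  exists l, forall e : R, 0 < e ->
    exists n0, forall n, (n0 <= n)%N -> rnorm (u n - l) < e.
Proof.
move=> cau; pose D := `|C| + 1; have D0 : 0 < D by rewrite ltr_wpDl.
have small e : 0 < e -> exists n0, forall n, (n0 <= n)%N -> D * n.+1%:R^-1 < e.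
  move=> e0; exists (Num.truncn (D / e)) => n len.
  rewrite ltr_pdivrMr // -ltr_pdivrMl // mulrC.
  by apply: lt_le_trans (truncnS_gt _) _; rewrite ler_nat.
have cauD i j : rnorm (u i - u j) <= D * i.+1%:R^-1 + D * j.+1%:R^-1.
  rewrite -mulrDr; apply: le_trans (cau i j) _; rewrite ler_wpM2r ?addr_ge0 //.
  by have := ler_norm C; rewrite /D; lra.
clearbody D.
have cvgu : cvg (u n @[n --> \oo]).
  apply: cauchy_cvg; apply: cauchy_exP => e e0.
  have [r eE] : exists r, e = r%:C.
    by exists (complex.Re e); rewrite RRe_real // gtr0_real.
  move: e0; rewrite eE ltcR => r0; have r2 : 0 < r / 2 by lra.
  have [n0 n0P] := small _ r2.
  exists (u n0); exists n0 => // n /= n0n; rewrite -ball_normE /= rnormE ltcR.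
  have h1 := n0P _ (leqnn n0); have h2 := n0P _ n0n.
  apply: le_lt_trans (cauD n0 n) _; move: h1 h2.
  by move: (D * _) (D * _) => a b; lra.
exists (lim (u n @[n --> \oo])) => e e0.
have : nbhs (lim (u n @[n --> \oo])) [set y | rnorm (lim (u n @[n --> \oo]) -
  y) < e].
  by apply/near_rnorm; exists e.
move=> /cvgu[n0 _ n0P]; exists n0 => n n0n.
by rewrite rnormB; apply: (n0P n).
Qed.

(** * Symmetric operators *)

(** A definite inner product with values in a module [V], which carries an
    isometric involution [st] and a norm [vn]: the common ground of Hilbert
    modules and Hilbert spaces. *)
Record hermitian_form (R : realType) (E : normedModType R[i])
    (V : lmodType R[i]) (ip : E -> E -> V) (st : V -> V) (vn : V ->
      R) : Prop := HermitianForm {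
  hf_normD : forall u v, vn (u + v) <= vn u + vn v;
  hf_normZ : forall k v, vn (k *: v) = rnorm k * vn v;
  hf_norm_eq0 : forall v, vn v = 0 -> v = 0;
  hf_starD : forall u v, st (u + v) = st u + st v;
  hf_starZ : forall k v, st (k *: v) = conjc k *: st v;
  hf_norm_star : forall v, vn (st v) = vn v;
  hf_innerD : forall x y z, ip x (y + z) = ip x y + ip x z;
  hf_innerZ : forall k x y, ip x (k *: y) = k *: ip x y;
  hf_inner_star : forall x y, st (ip x y) = ip y x;
  hf_normE : forall x, vn (ip x x) = rnorm x ^+ 2
}.

Section SymmetricOperators.
Variables (R : realType) (E : completeNormedModType R[i]) (V : lmodType R[i]).
Variables (ip : E -> E -> V) (st : V -> V) (vn : V -> R).
Hypothesis form : hermitian_form ip st vn.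
Implicit Types (x y z w : E) (k c : R[i]) (r e : R) (S : set (E * E)).

Let vnD := hf_normD form.
Let vnZ := hf_normZ form.
Let vn_eq0 := hf_norm_eq0 form.
Let stD := hf_starD form.
Let stZ := hf_starZ form.
Let vn_st := hf_norm_star form.
Let ipD := hf_innerD form.
Let ipZ := hf_innerZ form.
Let ip_st := hf_inner_star form.
Let ip_norm := hf_normE form.

Let ipDl x y z : ip (x + y) z = ip x z + ip y z.
Proof. by rewrite -ip_st ipD stD !ip_st. Qed.

Let ipZl k x y : ip (k *: x) y = conjc k *: ip x y.
Proof. by rewrite -ip_st ipZ stZ ip_st. Qed.

Let ipNr x y : ip x (- y) = - ip x y.
Proof. by rewrite -(scaleN1r y) ipZ scaleN1r. Qed.

Let ipNl x y : ip (- x) y = - ip x y.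
Proof. by rewrite -(scaleN1r x) ipZl conjcN conjc1 scaleN1r. Qed.

Let vnN v : vn (- v) = vn v.
Proof. by rewrite -scaleN1r vnZ rnormN rnorm1 mul1r. Qed.

Let vn0 : vn 0 = 0.
Proof. by rewrite -(scale0r 0) vnZ rnorm0 mul0r. Qed.

Let vn_ge0 v : 0 <= vn v.
Proof. by have := vnD v (- v); rewrite subrr vn0 vnN; lra. Qed.

Let ip_eq0 x : ip x x = 0 -> x = 0.
Proof.
move=> x0; apply: rnorm_eq0; apply/eqP; rewrite -sqrf_eq0 -ip_norm x0.
by rewrite vn0.
Qed.

Lemma ip_polarization x y : ip x y = (4^-1)%:C *:
  ((ip (x + y) (x + y) - ip (x - y) (x - y)) -
   'i *: (ip (x + 'i *: y) (x + 'i *: y) - ip (x - 'i *: y) (x - 'i *: y))).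
Proof.
rewrite !(ipDl, ipD, ipNl, ipNr, ipZl, ipZ) conjci !realcE.
module_eq V; try field.
  by transitivity ((2 + 2 * ('i * 'i) : R[i]) / 4); [rewrite mulii|]; field.
by transitivity ((2 - 2 * ('i * 'i) : R[i]) / 4); [rewrite mulii|]; field.
Qed.

Lemma vn_ip_le_sqr x y : vn (ip x y) <= (rnorm x + rnorm y) ^+ 2.
Proof.
have bound w : rnorm w = rnorm y ->
  vn (ip (x + w) (x + w)) <= (rnorm x + rnorm y) ^+ 2.
  move=> wy; rewrite ip_norm ler_pXn2r ?nnegrE ?addr_ge0 ?rnorm_ge0 //.
  by rewrite -wy rnormD.
have iy : rnorm ('i *: y) = rnorm y by rewrite rnormZ rnormi mul1r.
rewrite ip_polarization vnZ rnorm_real ger0_norm ?invr_ge0 //.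
have vnB u v : vn (u - v) <= vn u + vn v by rewrite -(vnN v) vnD.
set a := ip _ _; set b := ip _ _; set c := ip _ _; set d := ip _ _.
have := vnB (a - b) ('i *: (c - d)); rewrite vnZ rnormi mul1r.
have := vnB a b; have := vnB c d.
have : vn a <= (rnorm x + rnorm y) ^+ 2 by apply: bound.
have : vn b <= (rnorm x + rnorm y) ^+ 2 by apply: bound; rewrite rnormN.
have : vn c <= (rnorm x + rnorm y) ^+ 2 by apply: bound.
have : vn d <= (rnorm x + rnorm y) ^+ 2 by apply: bound; rewrite rnormN.
by lra.
Qed.

(** A Cauchy-Schwarz inequality with a constant, which suffices for continuity
    and, unlike the sharp one, follows from polarization without an order on
    [V]. *)
Lemma vn_ip_le x y : vn (ip x y) <= 4 * rnorm x * rnorm y.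
Proof.
have pos z : rnorm z != 0 -> 0 < rnorm z.
  by move=> z0; rewrite lt_neqAle eq_sym z0 rnorm_ge0.
have zero z w : vn (ip (0 *: z) w) = 0 /\ vn (ip w (0 *: z)) = 0.
  by rewrite ipZl ipZ !vnZ rnorm_conj !rnorm0 !mul0r.
have [/rnorm_eq0 x0|/pos x0] := eqVneq (rnorm x) 0.
  have [-> _] : vn (ip x y) = 0 /\ True by rewrite x0 -(scale0r 0) (zero 0 y).1.
  by rewrite x0 rnorm0 mulr0 mul0r.
have [/rnorm_eq0 y0|/pos y0] := eqVneq (rnorm y) 0.
  have [-> _] : vn (ip x y) = 0 /\ True by rewrite y0 -(scale0r 0) (zero 0 x).2.
  by rewrite y0 rnorm0 mulr0.
have unit z : 0 < rnorm z -> rnorm ((rnorm z)^-1%:C *: z) = 1.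
  by move=> z0; rewrite rnormZ rnorm_real gtr0_norm ?invr_gt0 // mulVf ?gt_eqF.
have := vn_ip_le_sqr ((rnorm x)^-1%:C *: x) ((rnorm y)^-1%:C *: y).
rewrite !unit // ipZl ipZ !vnZ rnorm_conj !rnorm_real !gtr0_norm ?invr_gt0 //.
rewrite ler_pdivrMl // ler_pdivrMl //.
by rewrite -[(1 + 1) ^+ 2]/((1 + 1) ^+ 2 : R); lra.
Qed.

Lemma ip_dense_eq0 (D : set E) w :
  dense D -> (forall z, D z -> ip z w = 0) -> w = 0.
Proof.
move=> /dense_rnorm dD zw; apply: rnorm_eq0; apply/eqP.
rewrite eq_le rnorm_ge0 andbT; apply/ler_addgt0Pr => e e0; rewrite add0r.
have [w0|w0] := eqVneq (rnorm w) 0; first by rewrite w0 ltW.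
have w_gt0 : 0 < rnorm w by rewrite lt_neqAle eq_sym w0 rnorm_ge0.
have e4 : 0 < e / 4 by lra.
have [z Dz wz] := dD w _ e4.
rewrite -(ler_pM2r w_gt0) -expr2 -ip_norm.
have -> : ip w w = ip (w - z) w by rewrite ipDl ipNl (zw z) // subr0.
by apply: le_trans (vn_ip_le _ _) _; rewrite ler_pM2r //; lra.
Qed.

Definition symmetric_graph S :=
  forall x w y z, S (x, w) -> S (y, z) -> ip w y = ip x z.

(** Linearity is automatic: the adjoint relation determines the value at [x] by
    pairings with a dense set. *)
Lemma symmetric_graph_linear S : functional S -> Defs.subspace (op_dom S) ->
  dense (op_dom S) -> S `<=` op_adjoint ip S -> Defs.subspace S.
Proof.
move=> fS [D0 DD DZ] dS sS.
have eq x w w' : S (x, w) -> (forall a b, S (a, b) -> ip b x = ip a w') ->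
  S (x, w').
  move=> Sxw h; suff : w - w' = 0 by move=> /eqP; rewrite subr_eq0 => /eqP <-.
  apply: (ip_dense_eq0 dS) => a [b Sab].
  by rewrite ipD ipNr -(h _ _ Sab) (sS _ Sxw _ _ Sab) subrr.
split.
- have [w S0] := D0; apply: (eq _ _ _ S0) => a b Sab.
  by rewrite -(scale0r 0) !ipZ !scale0r.
- move=> [x w] [x' w'] Sx Sx'.
  have [||y Sy] := DD x x'; [by exists w|by exists w'|].
  apply: (eq _ _ _ Sy) => a b Sab.
  by rewrite !ipD (sS _ Sx _ _ Sab) (sS _ Sx' _ _ Sab).
- move=> k [x w] Sx; have [|y Sy] := DZ k x; first by exists w.
  apply: (eq _ _ _ Sy) => a b Sab.
  by rewrite !ipZ (sS _ Sx _ _ Sab).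
Qed.

Lemma symmetric_graph_functional S : dense (op_dom S) ->
  Defs.subspace S -> symmetric_graph S -> functional S.
Proof.
move=> dS [_ SD SZ] sS x y z Sy Sz.
apply/eqP; rewrite -subr_eq0; apply/eqP/(ip_dense_eq0 dS) => a [b Sab].
by rewrite ipD ipNr -(sS _ _ _ _ Sab Sy) -(sS _ _ _ _ Sab Sz) subrr.
Qed.

Lemma symmetric_graph_closure S : symmetric_graph S ->
  symmetric_graph (closure S).
Proof.
move=> sS x w y z /closure_rnorm Sxw /closure_rnorm Syz.
apply/eqP; rewrite -subr_eq0; apply/eqP/vn_eq0/eqP; rewrite eq_le vn_ge0 andbT.
pose C := 4 * (rnorm w + rnorm y + rnorm x + rnorm z + 2).
have C0 : 0 < C.
  by have := rnorm_ge0 w; have := rnorm_ge0 y; have := rnorm_ge0 x;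
    have := rnorm_ge0 z; rewrite /C; lra.
apply/ler_addgt0Pr => e' e'0; rewrite add0r.
pose e := Num.min 1 (e' / C).
have e0 : 0 < e by rewrite lt_min ltr01 divr_gt0.
have e1 : e <= 1 by rewrite ge_min lexx.
have eC : e * C <= e' by rewrite -ler_pdivlMr // ge_min lexx orbT.
have [[a b] /= Sab [xa wb]] := Sxw _ e0.
have [[c d] /= Scd [yc zd]] := Syz _ e0.
have -> : ip w y - ip x z = ip (w - b) y + ip b (y - c) - ip (x - a) z - ip a
  (z - d).
  rewrite !(ipD, ipDl, ipNl, ipNr) (sS _ _ _ _ Sab Scd); module_eq V.
have nb : rnorm b <= rnorm w + 1.
  have -> : b = w - (w - b) by rewrite subKr.
  by apply: le_trans (rnormD _ _) _; rewrite rnormN; lra.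
have na : rnorm a <= rnorm x + 1.
  have -> : a = x - (x - a) by rewrite subKr.
  by apply: le_trans (rnormD _ _) _; rewrite rnormN; lra.
have b1 : vn (ip (w - b) y) <= 4 * e * rnorm y.
  apply: le_trans (vn_ip_le _ _) _; rewrite ler_wpM2r ?rnorm_ge0 //; lra.
have b2 : vn (ip b (y - c)) <= 4 * (rnorm w + 1) * e.
  apply: le_trans (vn_ip_le _ _) _; apply: ler_pM;
    rewrite ?mulr_ge0 ?rnorm_ge0 //; lra.
have b3 : vn (ip (x - a) z) <= 4 * e * rnorm z.
  apply: le_trans (vn_ip_le _ _) _; rewrite ler_wpM2r ?rnorm_ge0 //; lra.
have b4 : vn (ip a (z - d)) <= 4 * (rnorm x + 1) * e.
  apply: le_trans (vn_ip_le _ _) _; apply: ler_pM;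
    rewrite ?mulr_ge0 ?rnorm_ge0 //; lra.
have := vnD (ip (w - b) y + ip b (y - c) - ip (x - a) z) (- ip a (z - d)).
have := vnD (ip (w - b) y + ip b (y - c)) (- ip (x - a) z).
have := vnD (ip (w - b) y) (ip b (y - c)); rewrite !vnN.
by move: eC; rewrite /C; lra.
Qed.

(** The range of [S + c]. *)
Definition shifted_range S c : set E :=
  [set u | exists2 p, S p & u = p.2 + c *: p.1].

Section Shift.
Variables (S : set (E * E)) (c : R[i]).
Hypotheses (cJ : conjc c = - c) (cc : c * c = - 1).
Hypotheses (linS : Defs.subspace S) (symS : symmetric_graph S).

Let c1 : rnorm c = 1.
Proof. exact: rnorm_sqrtN1. Qed.

(** [<z, z>] is the imaginary part of [<(S + c) z, z>] up to a factor of modulus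
    one, as [<S z, z>] is selfadjoint. *)
Lemma resolvent_bound z w : S (z, w) -> rnorm z <= 4 * rnorm (w + c *: z).
Proof.
move=> Szw; have [z0|z0] := eqVneq (rnorm z) 0.
  by rewrite z0 mulr_ge0 ?rnorm_ge0.
have z_gt0 : 0 < rnorm z by rewrite lt_neqAle eq_sym z0 rnorm_ge0.
rewrite -(ler_pM2r z_gt0) -expr2 -ip_norm; apply: le_trans (vn_ip_le _ _).
set u := ip (w + c *: z) z.
have -> : ip z z = (2^-1)%:C *: (c *: (u - st u)).
  rewrite /u ipDl ipZl cJ stD stZ !ip_st -(symS Szw Szw) conjcN cJ !realcE.
  module_eq V; try field.
  by transitivity (- (c * c)); [rewrite cc; ring|field].
rewrite !vnZ c1 mul1r rnorm_real ger0_norm ?invr_ge0 //.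
by have := vnD u (- st u); rewrite vnN vn_st; lra.
Qed.

(** [S + c] is bounded below and closed, so that its range is closed. *)
Lemma shifted_range_full : closed S -> dense (shifted_range S c) ->
  forall u, shifted_range S c u.
Proof.
move=> clS /dense_rnorm dS u.
have pick n : exists p : E * E, S p /\ rnorm (u - (p.2 + c *: p.1)) <
  n.+1%:R^-1.
  have [|_ [p Sp ->] up] := dS u (n.+1%:R^-1); first by rewrite invr_gt0.
  by exists p.
have [p pP] := choice pick; have [S0 SD SZ] := linS.
have [|z zlim] := @complete_limit R E (fun n => (p n).1) 4.
  move=> i j; have [Si ui] := pP i; have [Sj uj] := pP j.
  have Sij : S ((p i).1 - (p j).1, (p i).2 - (p j).2).
    have := SD _ _ Si (SZ (-1) _ Sj); rewrite scaleN1r.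
    by case: (p i) (p j) => [? ?] [? ?].
  apply: le_trans (resolvent_bound Sij) _; rewrite ler_pM2l //.
  have -> : (p i).2 - (p j).2 + c *: ((p i).1 - (p j).1) =
    (u - ((p j).2 + c *: (p j).1)) - (u - ((p i).2 + c *: (p i).1))
      by module_eq E.
  apply: le_trans (rnormD _ _) _; rewrite rnormN addrC.
  by apply: lerD; apply: ltW.
exists (z, u - c *: z) => /=; last by rewrite subrK.
apply: clS; apply/closure_rnorm => e e0 /=; have e2 : 0 < e / 2 by lra.
have [n0 n0P] := zlim _ e2.
pose n := maxn n0 (Num.truncn (e / 2)^-1).
have n0n : (n0 <= n)%N by rewrite leq_maxl.
have small : n.+1%:R^-1 < e / 2.
  rewrite -[ltRHS]invrK ltf_pV2 ?posrE ?invr_gt0 //.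
  by apply: lt_le_trans (truncnS_gt _) _; rewrite ler_nat ltnS leq_maxr.
have [Sn un] := pP n; exists (p n) => //.
have zn : rnorm (z - (p n).1) < e / 2 by rewrite rnormB; apply: n0P.
split; first by lra.
have -> : u - c *: z - (p n).2 =
  (u - ((p n).2 + c *: (p n).1)) - c *: (z - (p n).1) by module_eq E.
apply: le_lt_trans (rnormD _ _) _; rewrite rnormN rnormZ c1 mul1r.
by have := lt_trans un small; lra.
Qed.

(** If both shifts are onto, [S] has no proper symmetric extension: any point
    of the graph of the adjoint differs from a point of [S] by some [(d, c d)],
    and [d] is orthogonal to the range of [S + c]. *)
Lemma selfadjoint_of_full_ranges :
  (forall u, shifted_range S c u) -> (forall u, shifted_range S (- c) u) ->
  S = op_adjoint ip S.
Proof.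
have [S0 SD SZ] := linS.
move=> full fullN; apply/seteqP; split=> [[y z] Syz x w Sxw|[y z] /= adj].
  exact: symS Sxw Syz.
have [[a b] /= Sab zab] := fullN (z + - c *: y).
pose d := y - a.
have ze : z - b = c *: d.
  have -> : z = b + - c *: a - - c *: y by rewrite -zab addrK.
  by rewrite /d; module_eq E.
have orth u : ip u d = 0.
  have [[x w] /= Sxw ->] := full u.
  have : ip w d = ip x (z - b).
    by rewrite /d !(ipD, ipNr) (adj _ _ Sxw) (symS Sxw Sab).
  by rewrite ze ipDl ipZl cJ ipZ scaleNr => ->; rewrite subrr.
have d0 := ip_eq0 (orth d).
have -> : y = a by apply/eqP; rewrite -subr_eq0 -/d d0.
have -> // : z = b by apply/eqP; rewrite -subr_eq0 ze d0 scaler0.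
Qed.

End Shift.

Lemma selfadjoint_of_dense_ranges S : closed S -> Defs.subspace S ->
  symmetric_graph S -> dense (shifted_range S 'i) ->
  dense (shifted_range S (- 'i)) -> S = op_adjoint ip S.
Proof.
move=> clS linS symS dp dm; have iJ := conjci R.
have ii := mulii R.
have iNJ : conjc (- 'i) = - - 'i :> R[i] by rewrite conjcN iJ.
have iiN : - 'i * - 'i = -1 :> R[i] by rewrite mulrNN.
apply: (selfadjoint_of_full_ranges iJ) => //.
  exact: (shifted_range_full iJ ii).
exact: (shifted_range_full iNJ iiN).
Qed.

End SymmetricOperators.

(** * Orthogonality in Hilbert spaces *)

Lemma hs_hermitian_form (R : realType) (H : hilbertSpace R) :
  hermitian_form (@hs_inner R H) conjc (@rnorm R R[i]).
Proof.
split.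
- exact: rnormD.
- exact: rnormM.
- exact: rnorm_eq0.
- exact: conjcD.
- exact: conjcM.
- exact: rnorm_conj.
- exact: hs_innerD.
- exact: hs_innerZ.
- exact: hs_inner_conj.
- move=> x; rewrite -hs_normE rnormE !expr2 -realcM rnorm_real ger0_norm //.
  by rewrite mulr_ge0 ?rnorm_ge0.
Qed.

Lemma hm_hermitian_form (R : realType) (A : cstarAlgebra R) (E : hilbertModule
  A) :
  hermitian_form (@hm_inner R A E) (@cs_star R A) (@rnorm R A).
Proof.
split.
- exact: rnormD.
- exact: rnormZ.
- exact: rnorm_eq0.
- exact: cs_starD.
- exact: cs_starZ.
- exact: cs_rnorm_star.
- exact: hm_innerD.
- exact: hm_innerZ.
- exact: hm_inner_star.
- exact: hm_rnormE.
Qed.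

Section HilbertProjection.
Variables (R : realType) (H : hilbertSpace R).
Implicit Types (x y z u m : H) (M : set H).
Local Notation ip := (@hs_inner R H).

Lemma hs_innerJ x y : conjc (ip x y) = ip y x.
Proof. exact: hs_inner_conj. Qed.

Lemma hs_innerDl x y z : ip (x + y) z = ip x z + ip y z.
Proof. by rewrite -hs_innerJ hs_innerD conjcD !hs_innerJ. Qed.

Lemma hs_innerZl k x y : ip (k *: x) y = conjc k * ip x y.
Proof. by rewrite -hs_innerJ hs_innerZ conjcM hs_innerJ. Qed.

Lemma hs_innerNr x y : ip x (- y) = - ip x y.
Proof. by rewrite -(scaleN1r y) hs_innerZ mulN1r. Qed.

Lemma hs_innerNl x y : ip (- x) y = - ip x y.
Proof. by rewrite -hs_innerJ hs_innerNr conjcN hs_innerJ. Qed.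

Definition hs_innerE :=
  (hs_innerDl, hs_innerD, hs_innerNl, hs_innerNr, hs_innerZl, hs_innerZ).

Lemma hs_inner_rnorm x : ip x x = (rnorm x ^+ 2)%:C.
Proof. by rewrite -hs_normE rnormE !expr2 realcM. Qed.

Lemma hs_parallelogram x y :
  rnorm (x + y) ^+ 2 + rnorm (x - y) ^+ 2 = 2 * rnorm x ^+ 2 + 2 * rnorm y ^+ 2.
Proof.
apply: (@complexI R); rewrite !realcD !(realcM 2) -!hs_inner_rnorm !hs_innerE.
by rewrite realc_nat; ring.
Qed.

(** First variation of [|u - k m|^2], along [k = t <m, u>] with the value of [t]
    for which the quadratic term is at most half of the linear one. *)
Lemma hs_orthogonal_of_minimal u m :
  (forall k : R[i], rnorm u <= rnorm (u - k *: m)) -> ip m u = 0.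
Proof.
move=> min; set q := ip m u; apply: rnorm_eq0.
pose t := (rnorm m ^+ 2 + 1)^-1.
have m2 : 0 <= rnorm m ^+ 2 by rewrite sqr_ge0.
have m1 : 0 < rnorm m ^+ 2 + 1 by lra.
have t0 : 0 < t by rewrite invr_gt0.
have tm : t * (rnorm m ^+ 2 + 1) = 1 by rewrite mulVf // gt_eqF.
clearbody t.
have expand : rnorm (u - (t%:C * q) *: m) ^+ 2 =
    rnorm u ^+ 2 - 2 * t * rnorm q ^+ 2 + t ^+ 2 * rnorm q ^+ 2 * rnorm m ^+ 2.
  apply: (@complexI R); rewrite -hs_inner_rnorm !hs_innerE.
  have -> : ip u m = conjc q by rewrite -hs_innerJ.
  have qq : q * conjc q = (rnorm q)%:C * (rnorm q)%:C.
    by rewrite -sqr_normc rnormE expr2.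
  rewrite !hs_inner_rnorm conjcM conjc_real -/q.
  move: (rnorm q) (rnorm u) (rnorm m) qq => n2 n1 n3 qq.
  by rewrite !expr2 !realcE; ring: qq.
have := min (t%:C * q).
rewrite -(ler_pXn2r (n := 2)) ?nnegrE ?rnorm_ge0 // expand => le.
have q0 : 0 <= rnorm q ^+ 2 by rewrite sqr_ge0.
apply/eqP; rewrite -sqrf_eq0 eq_le q0 andbT.
rewrite -(pmulr_rle0 _ t0).
have : t ^+ 2 * rnorm q ^+ 2 * rnorm m ^+ 2 = t * rnorm q ^+ 2 - t ^+ 2 *
  rnorm q ^+ 2.
  have -> : t ^+ 2 * rnorm q ^+ 2 * rnorm m ^+ 2 =
    t * (rnorm m ^+ 2 + 1) * (t * rnorm q ^+ 2) - t ^+ 2 * rnorm q ^+ 2 by ring.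
  by rewrite tm mul1r.
have : 0 <= t ^+ 2 * rnorm q ^+ 2 by rewrite mulr_ge0 ?sqr_ge0.
by lra.
Qed.

(** By the parallelogram law a minimizing sequence in [M] for the distance to
    [h] is Cauchy; its limit [l] makes [h - l] orthogonal to [M], so [h = l]. *)
Lemma hs_dense_of_orthogonal M : Defs.subspace M ->
  (forall u, (forall m, M m -> ip m u = 0) -> u = 0) -> dense M.
Proof.
move=> [M0 MD MZ] orth; apply/dense_rnorm => h e e0.
pose D := [set rnorm (h - m) ^+ 2 | m in M].
have infD : has_inf D.
  split; first by exists (rnorm (h - 0) ^+ 2); exists 0.
  by exists 0 => _ [m _ <-]; rewrite sqr_ge0.
have infle m : M m -> inf D <= rnorm (h - m) ^+ 2.
  by move=> Mm; apply: ge_inf; [case: infD|exists m].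
pose a n : R := n.+1%:R^-1.
have a0 n : 0 < a n by rewrite invr_gt0.
have pick n : exists m, M m /\ rnorm (h - m) ^+ 2 <= inf D + a n ^+ 2.
  have [|_ [m Mm <-] lt] := @inf_adherent _ D (a n ^+ 2) _ infD.
    by rewrite exprn_gt0.
  by exists m; split=> //; apply: ltW.
have [f fP] := choice pick.
have mid i j : M ((2^-1)%:C *: (f i + f j)).
  by apply: MZ; apply: MD; [case: (fP i)|case: (fP j)].
have [|l lP] := @complete_limit R H f 2.
  move=> i j; rewrite -/(a i) -/(a j).
  have ai := a0 i; have aj := a0 j.
  rewrite -(ler_pXn2r (n := 2)) ?nnegrE ?rnorm_ge0 //; last first.
    by rewrite mulr_ge0 // addr_ge0 // ltW.
  have [_ fi] := fP i; have [_ fj] := fP j.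
  have := hs_parallelogram (h - f j) (h - f i).
  have -> : h - f j - (h - f i) = f i - f j by module_eq H.
  have -> : h - f j + (h - f i) = 2%:C *: (h - (2^-1)%:C *: (f i + f j)).
    by rewrite !realcE; module_eq H; field.
  rewrite rnormZ rnorm_real ger0_norm // exprMn.
  have := infle _ (mid i j).
  move: (a i) (a j) ai aj fi fj => b c b0 c0 fi fj.
  have : 0 <= b * c by rewrite mulr_ge0 ?ltW.
  have := sqr_ge0 b; have := sqr_ge0 c.
  have -> : (2 * (b + c)) ^+ 2 = 4 * b ^+ 2 + 8 * (b * c) + 4 * c ^+ 2 by ring.
  by lra.
have hl : h - l = 0.
  apply: orth => m Mm; apply: hs_orthogonal_of_minimal => k.
  apply/ler_addgt0Pr => r r0; have r3 : 0 < r / 3 by lra.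
  have [n0 n0P] := lP _ r3.
  pose n := maxn n0 (Num.truncn (r / 3)^-1).
  have an : a n < r / 3.
    rewrite -[ltRHS]invrK ltf_pV2 ?posrE ?invr_gt0 //.
    by apply: lt_le_trans (truncnS_gt _) _; rewrite ler_nat ltnS leq_maxr.
  have fl : rnorm (f n - l) < r / 3 by apply: n0P; rewrite leq_maxl.
  have [Mf fn] := fP n.
  have := infle _ (MD _ _ Mf (MZ k _ Mm)).
  set X := rnorm (h - (f n + k *: m)) => infX.
  have X0 : 0 <= X := rnorm_ge0 _.
  have le1 : rnorm (h - f n) <= X + a n.
    have an0 := a0 n.
    rewrite -(ler_pXn2r (n := 2)) ?nnegrE ?rnorm_ge0 ?addr_ge0 ?(ltW an0) //.
    by apply: le_trans fn _; nra.
  have le2 : rnorm (h - l) <= rnorm (h - f n) + rnorm (f n - l).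
    have -> : h - l = (h - f n) + (f n - l) by module_eq H.
    exact: rnormD.
  have le3 : X <= rnorm (h - l - k *: m) + rnorm (f n - l).
    rewrite /X -(rnormN (f n - l)).
    have -> : h - (f n + k *: m) = (h - l - k *: m) + - (f n - l).
      by module_eq H.
    exact: rnormD.
  by lra.
have [n0 /(_ _ (leqnn n0)) n0P] := lP _ e0.
exists (f n0); first by case: (fP n0).
by move/eqP: hl; rewrite subr_eq0 => /eqP ->; rewrite rnormB.
Qed.

End HilbertProjection.

(** * The local-global principle *)

Section Graphs.
Variables (R : realType) (E : completeNormedModType R[i]).
Implicit Types (S : set (E * E)).

Lemma op_dom_subspace S : Defs.subspace S -> Defs.subspace (op_dom S).
Proof.
move=> [S0 SD SZ]; split=> [|x y [w Sx] [z Sy]|k x [w Sx]].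
- by exists 0.
- by exists (w + z); apply: SD Sx Sy.
- by exists (k *: w); apply: SZ Sx.
Qed.

Lemma shifted_range_subspace S (c : R[i]) :
  Defs.subspace S -> Defs.subspace (shifted_range S c).
Proof.
move=> [S0 SD SZ]; split=> [|_ _ [p Sp ->] [q Sq ->]|k _ [p Sp ->]].
- by exists 0 => //=; rewrite scaler0 addr0.
- by exists (p + q); [exact: SD|move=> /=; module_eq E].
- by exists (k *: p); [exact: SZ|move=> /=; module_eq E].
Qed.

Lemma closure_subspace S : Defs.subspace S -> Defs.subspace (closure S).
Proof.
move=> [S0 SD SZ]; split.
- by apply: subset_closure.
- move=> p q /closure_rnorm Sp /closure_rnorm Sq; apply/closure_rnorm => e e0.
  have e2 : 0 < e / 2 by lra.
  have [p' Sp' [p1 p2]] := Sp _ e2; have [q' Sq' [q1 q2]] := Sq _ e2.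
  exists (p' + q'); first exact: SD.
  split => /=.
    have -> : p.1 + q.1 - (p'.1 + q'.1) = (p.1 - p'.1) + (q.1 - q'.1)
      by module_eq E.
    by apply: le_lt_trans (rnormD _ _) _; lra.
  have -> : p.2 + q.2 - (p'.2 + q'.2) = (p.2 - p'.2) + (q.2 - q'.2)
    by module_eq E.
  by apply: le_lt_trans (rnormD _ _) _; lra.
- move=> k p /closure_rnorm Sp; apply/closure_rnorm => e e0.
  have k1 : 0 < rnorm k + 1 by have := rnorm_ge0 k; lra.
  have [p' Sp' [p1 p2]] := Sp _ (divr_gt0 e0 k1).
  have scale x : rnorm x < e / (rnorm k + 1) -> rnorm (k *: x : E) < e.
    rewrite ltr_pdivlMr // rnormZ; have := rnorm_ge0 x.
    by rewrite mulrDr mulr1 mulrC; have := rnorm_ge0 k; nra.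
  exists (k *: p'); first exact: SZ.
  by split => /=; rewrite -scalerBr; apply: scale.
Qed.

End Graphs.

Section LocalizedGraph.
Variables (R : realType) (A : cstarAlgebra R) (E : hilbertModule A).
Variables (omega : {scalar A}) (st : is_state omega).
Variables (L : localizationSpace E omega) (T : set (E * E)).
Local Notation iota := (loc_map L).

Lemma loc_rnormE x : (rnorm (iota x) ^+ 2)%:C = omega (hm_inner x x).
Proof. by rewrite -hs_inner_rnorm loc_innerE. Qed.

Lemma loc_rnorm_le x : rnorm (iota x) <= rnorm x.
Proof.
have [_ le _] := st.
rewrite -(ler_pXn2r (n := 2)) ?nnegrE ?rnorm_ge0 // -hm_rnormE.
have := le (hm_inner x x); rewrite -loc_rnormE !rnormE lecR rnorm_real.
by rewrite ger0_norm // sqr_ge0.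
Qed.

Definition localized_graph : set (L * L) :=
  [set (iota p.1, iota p.2) | p in T].

Lemma localized_graph_subspace :
  Defs.subspace T -> Defs.subspace localized_graph.
Proof.
move=> [T0 TD TZ]; split=> [|_ _ [p Tp <-] [q Tq <-]|k _ [p Tp <-]].
- by exists 0; rewrite // !raddf0.
- by exists (p + q); [exact: TD|rewrite !linearD].
- by exists (k *: p); [exact: TZ|rewrite !linearZ].
Qed.

Lemma localized_graph_symmetric : symmetric_graph (@hm_inner R A E) T ->
  symmetric_graph (@hs_inner R L) localized_graph.
Proof.
move=> sT _ _ _ _ [[x w] /= Txw [<- <-]] [[y z] /= Tyz [<- <-]].
by rewrite !loc_innerE (sT _ _ _ _ Txw Tyz).
Qed.

Lemma dense_loc_image (D : set E) : dense D -> dense (iota @` D).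
Proof.
move=> /dense_rnorm dD; apply/dense_rnorm => h e e0; have e2 : 0 < e / 2 by lra.
have /dense_rnorm /(_ h _ e2)[_ [x _ <-] hx] := @loc_dense _ _ _ _ L.
have [y Dy xy] := dD x _ e2; exists (iota y); first by exists y.
have -> : h - iota y = (h - iota x) + iota (x - y) by rewrite raddfB;
  module_eq L.
apply: le_lt_trans (rnormD _ _) _; have := loc_rnorm_le (x - y); lra.
Qed.

Lemma dense_shifted_range_localization c : dense (shifted_range T c) ->
  dense (shifted_range (localization L T) c).
Proof.
move=> /dense_loc_image /dense_rnorm d; apply/dense_rnorm => h e e0.
have [_ [_ [p Tp ->] <-] hp] := d h e e0.
exists (iota (p.2 + c *: p.1)) => //; exists (iota p.1, iota p.2).
  by apply: subset_closure; exists p.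
by rewrite /= linearD linearZ.
Qed.

End LocalizedGraph.

Section LocalGlobal.
Variables (R : realType) (A : cstarAlgebra R) (E : hilbertModule A).
Variable T : set (E * E).
Hypothesis Tsym : symmetric_op T.
Let form := hm_hermitian_form E.

Lemma symmetric_op_graph : symmetric_graph (@hm_inner R A E) T.
Proof. by case: Tsym => _ sT x w y z Txw Tyz; apply: (sT _ Tyz). Qed.

Lemma symmetric_op_subspace : Defs.subspace T.
Proof.
by have [[fT [sub _] dT] sT] := Tsym; apply: (symmetric_graph_linear form fT).
Qed.

Lemma localization_selfadjoint omega (L : localizationSpace E omega) :
  is_state omega -> dense (shifted_range T 'i) ->
    dense (shifted_range T (- 'i)) ->
  hs_selfadjoint (localization L T).
Proof.
move=> st dp dm; have formL := hs_hermitian_form L; have [[_ _ dT] _] := Tsym.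
have symS : symmetric_graph (@hs_inner R L) (localization L T).
  apply: (symmetric_graph_closure formL).
  exact: localized_graph_symmetric symmetric_op_graph.
have linS : Defs.subspace (localization L T).
  by apply: closure_subspace;
    apply: localized_graph_subspace symmetric_op_subspace.
have denS : dense (op_dom (localization L T)).
  have /dense_rnorm d := dense_loc_image st (L := L) dT;
    apply/dense_rnorm => h e e0.
  have [_ [x [y Txy] <-] hx] := d h e e0; exists (loc_map L x) => //.
  by exists (loc_map L y); apply: subset_closure; exists (x, y).
split => //.
- exact: (symmetric_graph_functional formL denS).
- exact: op_dom_subspace.
- apply: (selfadjoint_of_dense_ranges formL) => //; first exact: closed_closure.
    exact: dense_shifted_range_localization.
  exact: dense_shifted_range_localization.
Qed.

(** For [y = T x] and [z = T y] the vector [y - c x] is mapped by [T + c] to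
    [z + x], because [c^2 = -1]. *)
Lemma dense_range_of_regular (c : R[i]) : c * c = -1 ->
  selfadjoint T -> regular T -> dense (shifted_range T c).
Proof.
move=> cc [_ TE] [_ _ /dense_rnorm dT]; apply/dense_rnorm => u e e0.
have [T0 TD TZ] := symmetric_op_subspace.
have [_ [x [y [z [Txy adj ->]]]] ux] := dT u e e0.
exists (x + z) => //; exists (y - c *: x, z - c *: y).
  have Tyz : T (y, z) by rewrite TE.
  by have := TD _ _ Tyz (TZ (- c) _ Txy); rewrite -!scaleNr.
rewrite /= scalerBr scalerA cc; module_eq E.
Qed.

(** A vector [u] orthogonal to the range of [S + c], where [S] is the
    localization, lies in the domain of the adjoint of [S], that is of [S], with
    [S u = c u]; this contradicts symmetry unless [u = 0]. *)
Lemma shifted_range_localization_dense omega (L : localizationSpace E omega)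
    (c : R[i]) :
  conjc c = - c -> c * c = -1 -> hs_selfadjoint (localization L T) ->
  dense (shifted_range (localization L T) c).
Proof.
move=> cJ cc [_ _ _ SE]; have [T0 TD TZ] := symmetric_op_subspace.
have linS : Defs.subspace (localization L T).
  by apply: closure_subspace;
    apply: localized_graph_subspace symmetric_op_subspace.
apply: hs_dense_of_orthogonal => [|u orth]; first exact: shifted_range_subspace.
have Su : localization L T (u, c *: u).
  rewrite SE => x w Sxw /=;
    have := orth (w + c *: x) (ex_intro2 _ _ (x, w) Sxw erefl).
  rewrite hs_innerDl hs_innerZl cJ hs_innerZ mulNr => /eqP.
  by rewrite subr_eq0 => /eqP.
have : hs_inner (c *: u) u = hs_inner u (c *: u).
  by have := Su; rewrite {1}SE => /(_ _ _ Su).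
rewrite hs_innerZl hs_innerZ cJ hs_inner_rnorm => /eqP.
have c0 : c != 0 by apply: contra_eq_neq cc => ->;
  rewrite mul0r eq_sym oppr_eq0 oner_eq0.
rewrite mulNr eq_sym -addr_eq0 -mulr2n mulrn_eq0 /= mulf_eq0 (negPf c0) /=.
rewrite (inj_eq (@complexI R) _ 0) sqrf_eq0 => /eqP; exact: rnorm_eq0.
Qed.

(** A state separating a point from the closure of the range of [T + c] would
    make the range of the localization of [T + c] non-dense. *)
Lemma dense_range_of_localizations (c : R[i]) :
  conjc c = - c -> c * c = -1 ->
  (forall omega : {scalar A}, is_state omega ->
    forall L : localizationSpace E omega, hs_selfadjoint (localization L T)) ->
  dense (shifted_range T c).
Proof.
move=> cJ cc loc; apply/dense_rnorm => x0 d d0; apply: contrapT => far.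
have away m : shifted_range T c m -> d <= rnorm (x0 - m).
  by move=> Tm; rewrite leNgt; apply/negP => lt; apply: far; exists m.
have linM := shifted_range_subspace c symmetric_op_subspace.
have [omega st [k k0 sep]] := state_separation linM d0 away.
have [omega0 _ _] := st; have [L _] := localizationSpace_exists E omega0.
have /dense_rnorm den := shifted_range_localization_dense cJ cc (loc _ st L).
pose r := Num.sqrt k; have r0 : 0 < r by rewrite sqrtr_gt0.
have r3 : 0 < r / 3 by lra.
have [_ [[z w] /= /closure_rnorm Szw ->] h1] := den (loc_map L x0) _ r3.
have [_ [[x y] /= Txy <-] [/= h2 h3]] := Szw _ r3.
have Mm : shifted_range T c (y + c *: x) by exists (x, y).
have c1 := rnorm_sqrtN1 cc.
have := sep _ Mm; rewrite -(@loc_rnormE _ _ _ _ L) lecR leNgt => /negP; apply.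
have rk : r ^+ 2 = k by rewrite sqr_sqrtr // ltW.
rewrite -rk ltr_pXn2r ?nnegrE ?rnorm_ge0 ?(ltW r0) //.
have -> : loc_map L (x0 - (y + c *: x)) = (loc_map L x0 - (w + c *: z)) +
    ((w - loc_map L y) + c *: (z - loc_map L x)).
  by rewrite linearB linearD linearZ /=; module_eq L.
apply: le_lt_trans (rnormD _ _) _.
have := rnormD (w - loc_map L y) (c *: (z - loc_map L x)).
rewrite rnormZ c1 mul1r; lra.
Qed.

End LocalGlobal.

Theorem theorem1p1 (R : realType) (A : cstarAlgebra R) (E : hilbertModule A)
    (T : set (E * E)) (Tclosed : closed T) (Tsym : symmetric_op T) :
  (selfadjoint T /\ regular T)
  <->
  (forall omega : {scalar A}, is_state omega ->
   forall Eomega : localizationSpace E omega,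
     hs_selfadjoint (localization Eomega T)).
Proof.
have cJ := conjci R; have cc := mulii R.
have cNJ : conjc (- 'i%C) = - - 'i%C :> R[i] by rewrite conjcN cJ.
have ccN : - 'i%C * - 'i%C = -1 :> R[i] by rewrite mulrNN.
split=> [[sT rT] omega st L|loc].
  apply: localization_selfadjoint => //; exact: dense_range_of_regular.
have dp := dense_range_of_localizations Tsym cJ cc loc.
have dm := dense_range_of_localizations Tsym cNJ ccN loc.
have form := hm_hermitian_form E; have symT := symmetric_op_graph Tsym.
have linT := symmetric_op_subspace Tsym; have [_ TD TZ] := linT.
have TE : T = adjoint T :=
  selfadjoint_of_dense_ranges form Tclosed linT symT dp dm.
have [ddT _] := Tsym; split; first by split.
have [_ _ dT] := ddT.
split=> //; first by split; rewrite // -TE.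
(* [1 + T^2] is onto: solve first with [T + i], then with [T - i]. *)
apply/dense_rnorm => u e e0; exists u; last by rewrite subrr rnorm0.
have [[a b] /= Tab ->] := shifted_range_full form cJ cc linT symT Tclosed dp u.
have [[x y] /= Txy aE] :=
  shifted_range_full form cNJ ccN linT symT Tclosed dm a.
have yE : y = a + 'i%C *: x by rewrite aE; module_eq E.
exists x, y, (b + 'i%C *: y); split=> //.
  have Ty : T (a + 'i%C *: x, b + 'i%C *: y) := TD _ _ Tab (TZ 'i%C _ Txy).
  by rewrite -TE {1}yE.
by rewrite yE scalerDr scalerA cc; module_eq E.
Qed.
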